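(* Let $\lambda$ be a partition with block form $(w_1^{h_1},\dots,w_N^{h_N})$ and at most $n$ rows, let $X=\{x_1\}$ with $x_1=[b_1](1,w_{b_1})$, let $\Phi_1:\mathbb S_\lambda(V)\to V\otimes\mathbb S_{\lambda\setminus X}(V)$ be the one-box removal map given by the sum over $1$-paths, and let $\widetilde\Phi_1:\mathbb S_\lambda(V)\to V\otimes\mathbb S_{\lambda\setminus X}(V)$ be the Pieri inclusion given by Olver. Then $$\Phi_1=-\widetilde\Phi_1 .$$
   Context: $V$ is a complex vector space of dimension $n$ with basis $e_1,\dots,e_n$. **Blocks.** Write $\lambda=(w_1^{h_1},\dots,w_N^{h_N})$ with $0<w_1<\dots<w_N$, where exactly $h_b\ge 1$ parts equal $w_b$. Block $[b]$ consists of the $h_b$ rows of length $w_b$ (block $1$ is geometrically lowest, block $N$ is at the top); $[b](i)$ is the $i$-th row of block $b$ counted from the bottom; $[b](i,j)$ is the box in column $j$ of that row. For boxes, $[b](i,j)\le[c](k,l)$ means $b<c$, or $b=c$ and $i\le k$ (weakly lower row); $<$ means strictly lower row. **Modules.** $\mathcal F_{\lambda,n}$ is the complex vector space with basis all fillings $T$ of $\lambda$ with entries in $\{1,\dots,n\}$. For a set $A$ of boxes, $w_A$ is the maximal length of a row containing a box of $A$, and $G_A=\sum_{\sigma}\sigma$ over all permutations $\sigma$ of the boxes preserving $A$ and fixing all boxes outside $A$ (acting on fillings). $\mathcal R_{\lambda,n}$ is the subspace spanned by all $T_1-T_2$ with $T_1,T_2$ equal up to permuting entries within rows, and all $G_A(T)$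 with $|A|>w_A$. $\mathbb S_\lambda(V)=\mathcal F_{\lambda,n}/\mathcal R_{\lambda,n}$. Both maps below are defined on fillings and descend to these quotients. **Evacuation route** starting at $[b_1]$: a set $R$ of boxes of $\lambda$ containing a box of row $[b_1](1)$, containing at most one box per row, and such that if $[b](i,j)\in R$ then $R$ contains a box of row $[b](k)$ for every $1\le k<i$. **$1$-path.** Let $Y=\{y_1\}$, $y_1=[N+1](1,1)$ an extra box attached above the diagram. A $1$-path $P$ removing $X$ is a map $P:\lambda\cup Y\to\lambda\cup Y$ of boxes together with an evacuation route $R=R^P$ starting at $[b_1]$ (which may or may not contain $x_1$) such that: $x\le P(x)$ for all $x$, and $x<P(x)$ for $x\in R$; the orbit $R_1=\{x_1,P(x_1),P^2(x_1),\dots\}$ contains $y_1$ and equals $R\cup X\cup Y$; if $[b](i,j),[b](k,l)\in R$ with $i<k$ and both images lie in $[b]$, then $P([b](i,j))<P([b](k,l))$; $P$ is the identity outside $R\cup X$, and $P(R\cup X)=(R\setminus X)\cup Y$. **The map $\Phi_1$.** $(-1)^P=(-1)^{h^P}$, $h^P$ the number of rows meeting $R^P$. For $b>b_1$, $H(b)=\sum_{j=b_1+1}^{b}(w_j-w_{j-1}+h_{j-1})$; $H(P)$ is the product of $H(b)$ over all $b>b_1$ with $R^P\cap[b]\neq\emptyset$. $P(T)=e_{\alpha}\otimes T_P$, where $\alpha$ is the entry of $T$ in the box of $\lambda$ mapped to $y_1$ and $T_P$ is the filling of $\lambda\setminus X$ whose entry in $c$ is the entry of $T$ in the unique box of $\lambda$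 mapped to $c$. Then $\Phi_1(T)=\sum_P\frac{(-1)^P}{H(P)}P(T)$, the sum over all $1$-paths $P$ removing $X$. **Olver's map $\widetilde\Phi_1$.** Number rows from the top, $\lambda=(\lambda_1\ge\lambda_2\ge\cdots)$, and let $k$ be the index of the row of $x_1$. For $J=(0=j_0<j_1<\dots<j_p=k)$, $p\ge1$, let $\tau_J(T)$ be the sum, over all choices of one box in each of the rows $j_1,\dots,j_p$, of $e_\alpha\otimes T'$, where $\alpha$ is the entry of the chosen box in row $j_1$ and $T'$ (of shape $\lambda\setminus X$, defined up to permuting entries within rows) is obtained by replacing, for $1\le i<p$, the chosen entry of row $j_i$ by the chosen entry of row $j_{i+1}$, and deleting the chosen entry from row $k$. Put $c_J=\prod_{i=1}^{p-1}(\lambda_{j_i}-\lambda_k+k-j_i)$. Then $\widetilde\Phi_1(T)=\sum_J\frac{(-1)^{p-1}}{c_J}\tau_J(T)$. *)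

(* Defs.v *)
From HB Require Import structures.
From mathcomp Require Import all_boot all_order perm all_algebra.
From mathcomp Require Import reals complex.

Set Implicit Arguments.
Unset Strict Implicit.
Unset Printing Implicit Defensive.

Import GRing.Theory.
Local Open Scope ring_scope.
Local Open Scope quotient_scope.

(* The quotient of a vector space by a subspace: MathComp's quotient of an
   additive group by a subgroup, equipped with the induced scaling. *)
Section VectorQuotient.
Variables (K : fieldType) (F : vectType K) (U : {vspace F}).

Definition vquot : Type := Quotient.quot (pred_of_vspace U : zmodClosed F).

HB.instance Definition _ := GRing.Zmodule.on vquot.

Definition vproj (x : F) : vquot := \pi_(Quotient.quot (pred_of_vspace U : zmodClosed F)) x.
Definition vscale (a : K) (q : vquot) : vquot := vproj (a *: repr q).

Lemma vproj_eq x y : (vproj x == vproj y) = (x - y \in U).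
Proof. by rewrite /vproj -Quotient.idealrBE. Qed.

Lemma vprojD x y : vproj (x + y) = vproj x + vproj y.
Proof. exact: (Quotient.pi_add (pred_of_vspace U : zmodClosed F) x y). Qed.

Lemma vproj_repr q : vproj (repr q) = q.
Proof. exact: reprK. Qed.

Lemma vprojZ a x : vproj (a *: x) = vscale a (vproj x).
Proof.
apply/eqP; rewrite vproj_eq -scalerBr; apply: memvZ.
by rewrite -vproj_eq vproj_repr.
Qed.

Fact vscaleA a b q : vscale a (vscale b q) = vscale (a * b) q.
Proof. by rewrite -[q]vproj_repr -!vprojZ scalerA. Qed.

Fact vscale1 : left_id 1 vscale.
Proof. by move=> q; rewrite -[q]vproj_repr -vprojZ scale1r. Qed.

Fact vscaleDr : right_distributive vscale +%R.
Proof.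
move=> a p q; rewrite -[p]vproj_repr -[q]vproj_repr.
by rewrite -vprojD -!vprojZ -vprojD scalerDr.
Qed.

Fact vscaleDl q : {morph vscale^~ q : a b / a + b}.
Proof.
by move=> a b; rewrite -[q]vproj_repr -!vprojZ -vprojD scalerDl.
Qed.

HB.instance Definition _ := GRing.Zmodule_isLmodule.Build K vquot
  vscaleA vscale1 vscaleDr vscaleDl.

Fact vproj_is_linear : linear vproj.
Proof. by move=> a x y; rewrite vprojD vprojZ. Qed.

HB.instance Definition _ := GRing.isLinear.Build K F vquot _ vproj
  vproj_is_linear.

End VectorQuotient.

(* A diagram is a finite type B of boxes together with the map [row] sending a
   box to its row.  This covers both lambda and lambda minus a box. *)
Section SchurModule.
Variables (K : fieldType) (n : nat) (rT B : finType) (row : B -> rT).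

Definition filling := {ffun B -> 'I_n}.
HB.instance Definition _ := Finite.on filling.

Definition fspace := {ffun filling -> K^o}.
HB.instance Definition _ := Vector.on fspace.

Definition fbasis (T : filling) : fspace := [ffun T' => (T' == T)%:R].

Definition permute (s : {perm B}) (T : filling) : filling :=
  [ffun x => T (s x)].

Definition row_equiv (T1 T2 : filling) : bool :=
  [exists s : {perm B},
     [forall x, row (s x) == row x] && (T2 == permute s T1)].

Definition max_row_length (A : {set B}) : nat :=
  \max_(x in A) #|[set y | row y == row x]|.

(* [perm_on A s]: s fixes every box outside A, hence also preserves A.  Summing
   over a group makes the choice between s and its inverse irrelevant. *)
Definition Gsum (A : {set B}) (T : filling) : fspace :=
  \sum_(s : {perm B} | perm_on A s) fbasis (permute s T).

Definition Rspace : {vspace fspace} :=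
  (\sum_(T1 : filling) \sum_(T2 : filling | row_equiv T1 T2)
      <[fbasis T1 - fbasis T2]> +
   \sum_(A : {set B} | (max_row_length A < #|A|)%N) \sum_(T : filling)
      <[Gsum A T]>)%VS.

Definition schur := vquot Rspace.
HB.instance Definition _ := GRing.Lmodule.on schur.

Definition cls (T : filling) : schur := vproj Rspace (fbasis T).

End SchurModule.

(* V is the space 'rV[K]_n with its standard basis e_1, ..., e_n.  The tensor
   product of V with W is represented by its coordinates in this basis: the
   family (w_a) stands for the sum over a of e_a tensor w_a. *)
Section Tensor.
Variables (K : fieldType) (n : nat) (W : lmodType K).

Definition tensV := {ffun 'I_n -> W}.
HB.instance Definition _ := GRing.Lmodule.on tensV.

Definition tens (v : 'rV[K]_n) (x : W) : tensV := [ffun a => v 0 a *: x].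

Definition e_ (a : 'I_n) : 'rV[K]_n := delta_mx 0 a.

End Tensor.

Arguments e_ {K n} a.

(* The partition lambda = (w_0^{h_0}, ..., w_{N-1}^{h_{N-1}}).  Blocks, rows
   inside a block (counted from the bottom) and columns are numbered from 0. *)
Section BlockPartition.
Variables (N : nat) (w h : nat -> nat).

Definition block_form : Prop :=
  [/\ forall b, (b < N)%N -> (0 < w b)%N,
      forall b c, (b < c)%N -> (c < N)%N -> (w b < w c)%N &
      forall b, (b < N)%N -> (0 < h b)%N].

Definition parts : seq nat :=
  flatten [seq nseq (h b) (w b) | b <- rev (iota 0 N)].

Definition lam (j : nat) : nat := nth 0%N parts j.-1.

Definition brow := {b : 'I_N & 'I_(h b)}.
HB.instance Definition _ := Finite.on brow.

Definition box := {r : brow & 'I_(w (tag r))}.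
HB.instance Definition _ := Finite.on box.

Definition box_row (x : box) : brow := tag x.
Definition box_block (x : box) : 'I_N := tag (tag x).

(* The number of a row when rows are counted from the top, starting at 1, so
   that the row r has length [lam (row_number r)]. *)
Definition row_number (r : brow) : nat :=
  \sum_((tag r).+1 <= c < N) h c + (h (tag r) - tagged r).

Lemma lam_row_number r : lam (row_number r) = w (tag r).
Proof.
case: r => b i; rewrite /lam /parts /row_number /=.
elim: N (b : nat) (i : nat) (ltn_ord b) (ltn_ord i) => [|M IH] {}b {}i //.
have -> : flatten [seq nseq (h c) (w c) | c <- rev (iota 0 M.+1)] =
    nseq (h M) (w M) ++ flatten [seq nseq (h c) (w c) | c <- rev (iota 0 M)].
  by rewrite -addn1 iotaD rev_cat map_cat flatten_cat /= cats0.
rewrite ltnS leq_eqVlt => /orP[/eqP-> iH|bM iH].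
  rewrite big_geq // add0n nth_cat size_nseq nth_nseq.
  by rewrite prednK ?subn_gt0 // leq_subr.
rewrite big_nat_recr //= (addnC _ (h M)) -addnA nth_cat size_nseq.
set s := (_ + (h b - i))%N.
have s0 : (0 < s)%N by rewrite addn_gt0 subn_gt0 iH orbT.
by rewrite -(prednK s0) addnS /= ltnNge leq_addr /= addKn; exact: IH.
Qed.

(* [x1] is the last box of the bottom row of the block [b1]. *)
Definition is_corner (b1 : 'I_N) (x1 : box) : Prop :=
  [/\ box_block x1 = b1, tagged (box_row x1) = 0%N :> nat
    & (tagged x1).+1 = w b1].

(* lambda together with y_1 is [option box]; [None] is y_1, the single box of
   an extra block of index N. *)
Definition xblock (x : option box) : nat :=
  if x is Some y then box_block y else N.
Definition xlevel (x : option box) : nat :=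
  if x is Some y then tagged (box_row y) else 0%N.

Definition box_le (x y : option box) : bool :=
  (xblock x < xblock y)%N ||
  ((xblock x == xblock y) && (xlevel x <= xlevel y)%N).
Definition box_lt (x y : option box) : bool :=
  (xblock x < xblock y)%N ||
  ((xblock x == xblock y) && (xlevel x < xlevel y)%N).

Definition evac_route (b1 : 'I_N) (R : {set box}) : bool :=
  [&& [exists x in R, (box_block x == b1) && (xlevel (Some x) == 0%N)],
      [forall x in R, forall y in R, (box_row x == box_row y) ==> (x == y)] &
      [forall x in R, forall r : brow,
         (tag r == box_block x) && (tagged r < tagged (box_row x))%N ==>
         [exists y in R, box_row y == r]]].

Definition one_path (x1 : box) (P : {ffun option box -> option box})
    (R : {set box}) : bool :=
  let Rs := [set Some x | x in R] in
  let X := [set Some x1] in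
  let Y := [set None] in
  [&& evac_route (box_block x1) R,
      [forall x, box_le x (P x)],
      [forall x in Rs, box_lt x (P x)],
      None \in orbit P (Some x1),
      [set x in orbit P (Some x1)] == Rs :|: X :|: Y,
      [forall x in Rs, forall y in Rs,
         [&& xblock x == xblock y, (xlevel x < xlevel y)%N,
             xblock (P x) == xblock x & xblock (P y) == xblock x] ==>
         box_lt (P x) (P y)],
      [forall x, (x \notin Rs :|: X) ==> (P x == x)] &
      P @: (Rs :|: X) == (Rs :\: X) :|: Y].

Variables (K : fieldType) (n : nat) (x1 : box).

Local Notation b1 := (box_block x1).

(* lambda \ X *)
Definition rbox := {x : box | x != x1}.
HB.instance Definition _ := Finite.on rbox.

Definition rbox_row (x : rbox) : brow := box_row (val x).

Definition Slam := schur K n box_row.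
HB.instance Definition _ := GRing.Lmodule.on Slam.

Definition Smu := schur K n rbox_row.
HB.instance Definition _ := GRing.Lmodule.on Smu.

Local Notation clsmu := (@cls K n brow rbox rbox_row).

Definition height (R : {set box}) : nat := #|[set box_row x | x in R]|.

Definition Hblock (b : nat) : K :=
  \sum_(b1.+1 <= j < b.+1) ((w j)%:R - (w j.-1)%:R + (h j.-1)%:R).

Definition Hpath (R : {set box}) : K :=
  \prod_(b < N | (b1 < b)%N && [exists x in R, box_block x == b]) Hblock b.

(* The box of lambda sent by P to c.  For a 1-path and c in (lambda \ X) or
   c = y_1 it exists and is unique; the default value is never used. *)
Definition source (P : {ffun option box -> option box}) (c : option box) : box :=
  odflt x1 [pick x | P (Some x) == c].

Definition path_act (P : {ffun option box -> option box})
    (T : filling n box) : tensV n Smu :=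
  tens (e_ (T (source P None)))
       (clsmu [ffun c : rbox => T (source P (Some (val c)))]).

Definition Phi1 (T : filling n box) : tensV n Smu :=
  \sum_(PR : {ffun option box -> option box} * {set box} |
          one_path x1 PR.1 PR.2)
     ((-1) ^+ height PR.2 / Hpath PR.2) *: path_act PR.1 T.

Local Notation k := (row_number (box_row x1)).

(* A sequence j_1 < ... < j_p = k of row numbers with 0 < j_1 is a p-tuple J,
   and a choice of one box in each of these rows is a p-tuple c of boxes. *)
Definition is_rows p (J : p.-tuple 'I_k.+1) : bool :=
  let s := [seq nat_of_ord j | j <- J] in
  path ltn 0%N s && (last 0%N s == k).

Definition is_choice p (J : p.-tuple 'I_k.+1) (c : p.-tuple box) : bool :=
  [seq row_number (box_row x) | x <- c] == [seq nat_of_ord j | j <- J].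

(* The filling T' attached to the choice c.  The entry of the last chosen box
   (in the row of x_1) is deleted; as the box missing from lambda \ X is x_1,
   the entry of x_1 takes the vacated place.  Any other arrangement of this row
   has the same class. *)
Definition shift_filling p (c : p.-tuple box) (T : filling n box) :
    filling n rbox :=
  [ffun y : rbox =>
     let i := index (val y) c in
     if (i.+1 < p)%N then T (nth x1 c i.+1)
     else if i.+1 == p then T x1
     else T (val y)].

Definition tau p (J : p.+1.-tuple 'I_k.+1) (T : filling n box) :
    tensV n Smu :=
  \sum_(c : p.+1.-tuple box | is_choice J c)
     tens (e_ (T (thead c))) (clsmu (shift_filling c T)).

Definition cJ p (J : p.-tuple 'I_k.+1) : K :=
  \prod_(j <- J | (j < k)%N) ((lam j)%:R - (lam k)%:R + k%:R - (j : nat)%:R).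

(* The length of J is p.+1, and 1 <= p.+1 <= k. *)
Definition olver (T : filling n box) : tensV n Smu :=
  \sum_(p < k) \sum_(J : p.+1.-tuple 'I_k.+1 | is_rows J)
     ((-1) ^+ p / cJ J) *: tau J T.

Definition induced_by (f : filling n box -> tensV n Smu)
    (phi : Slam -> tensV n Smu) : Prop :=
  forall T, phi (cls K box_row T) = f T.

End BlockPartition.

(* Main.v *)
Require Import Defs.
From HB Require Import structures.
From mathcomp Require Import all_boot all_order perm all_algebra.
From mathcomp Require Import reals complex zify ring.

Set Implicit Arguments.
Unset Strict Implicit.
Unset Printing Implicit Defensive.

Import GRing.Theory Num.Theory.
Local Open Scope ring_scope.

(** Both maps are sums over evacuation-like sets R of boxes: at most one box in
    each row, all in rows weakly above the row of x_1, that row included.  A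
    1-path P is forced by its set R, since the orbit of x_1 has to visit the
    boxes of R from the bottom to the top ([one_path_eq]), and a term of Olver's
    tau_J is such a set R as well, J being the set of rows that it meets.  Hence
    Phi_1(T) and Olver's sum combine the same vectors [slide R T]: the entries
    of R move up by one box along R, the topmost of them leaves, and the entry
    of x_1 goes to the box of R in its row, if that is another box.  The
    rows that R meets are arbitrary for Olver's map, but closed downwards inside
    each block for Phi_1, and the coefficients differ.

    Let A(S) be the sum of [slide R T] over all R meeting exactly the rows in S.
    The main point is that A(S + s) = - A(S) when the row s is below a row of S
    in the same block ([slide_rows_insert]).  Let y be the next box of R above
    the row s; its row has the same length as s.  Routing the move through a box
    x of s, instead of going directly to y, exchanges the final entries of x
    and y, and the sum over x of these exchanges is -1 modulo R_mu, by the
    relation G_A for A = (row s) + y ([garnir_swap]).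

    By iteration, (-1)^|S| A(S) depends only on the closure D of S under going
    down inside blocks ([alternating_down_closure]).  With H(b) as in the
    definition of Phi_1, Olver's factor attached to the row at height i (from 0)
    of the block b is H(b) + i, and the row of x_1 has no factor.  It remains to
    sum 1/c_S over the S with closure D ([sum_weights]).  In a block where D has
    m rows, its top row must be in S and the others are free, so that the sum is
      1/(H + m - 1) * prod_(i < m - 1) (1 + 1/(H + i)) = 1/H,
    a telescoping product, with value 1 in the block of x_1, whose bottom row is
    forced too.  The product over the blocks met by D is 1/H(P), and the signs
    (-1)^(p-1) and (-1)^h differ by -1. *)

(** * Sums, lists and linearity *)

(** Expanding the product, each element of D is either in S, with factor g, or
    outside it, with factor 1, and the second choice is open only outside A. *)
Lemma sum_subset_interval (K : comPzRingType) (I : finType) (g : I -> K)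
    (A D : {set I}) : A \subset D ->
  \sum_(S : {set I} | (A \subset S) && (S \subset D)) \prod_(r in S) g r =
  \prod_(r in D) (g r + (r \notin A)%:R).
Proof.
move=> AD; pose F r := if r \in D then g r else 0.
pose G r : K := (r \notin A)%:R.
rewrite [RHS]big_mkcond /= (eq_bigr (fun r => F r + G r)) => [|r _]; last first.
  rewrite /F /G; case: ifP => // rD; rewrite add0r.
  by rewrite (contraFN (subsetP AD r) rD).
rewrite bigA_distr big_mkcond /=; apply: eq_bigr => S _.
have [/andP[/subsetP AS /subsetP SD]|] := ifPn.
  rewrite big_mkcond /=; apply: eq_bigr => r _; case: ifPn => rS.
    by rewrite /F SD.
  by rewrite /G (contra (AS r) rS).
rewrite negb_and => /orP[] /subsetPn[r rin rout].
  by rewrite (bigD1 r) //= (negPf rout) /G rin mul0r.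
by rewrite (bigD1 r) //= rin /F (negPf rout) mul0r.
Qed.

Lemma uniq_map_inj_in (T1 T2 : eqType) (f : T1 -> T2) s :
  uniq (map f s) -> {in s &, injective f}.
Proof.
elim: s => //= a s IH /andP[nas /IH{}IH] x y; rewrite !inE.
case/predU1P=> [->|xs] /predU1P[->|ys] // e; last exact: IH.
- by rewrite e map_f in nas.
- by rewrite -e map_f in nas.
Qed.

(** Inserting x right after y in a cyclic list precomposes the successor map
    with the transposition of x and y: this is how a longer chain of moves is
    compared with a shorter one by a swap of two entries. *)
Lemma next_insert (T : finType) (p q : seq T) x y :
  uniq (p ++ [:: y, x & q]) ->
  next (p ++ [:: y, x & q]) =1 next (p ++ y :: q) \o tperm x y.
Proof.
move=> U.
have U' : uniq (p ++ y :: q).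
  apply: subseq_uniq U; apply: cat_subseq => //.
  exact: (@cat_subseq _ [:: y] q [:: y] (x :: q)) (subseq_cons q x).
move=> v /=; rewrite -(next_rot (size p) U) -(next_rot (size p) U').
rewrite !rot_size_cat.
have : uniq ([:: y, x & q] ++ p) by rewrite uniq_catC.
rewrite [uniq _]/= !mem_cat !inE !negb_or -!andbA => /and5P[yx _ xq xp _].
case: tpermP => [->|->|vx vy].
- by rewrite !next_nth /= !inE !eqxx (negPf yx) orbT.
- by rewrite [RHS]next_nth /= eqxx inE eq_sym (negPf yx) mem_cat (negPf xq) (negPf xp).
move/eqP/negPf: vx => vx; move/eqP/negPf: vy => vy.
by rewrite !next_nth !inE /= vx vy (eq_sym y) vy (eq_sym x) vx.
Qed.

Section Tens.
Variables (K : fieldType) (n : nat) (W : lmodType K).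

Lemma tens_is_linear (v : 'rV[K]_n) : linear (@tens K n W v).
Proof.
by move=> a x y; apply/ffunP => i; rewrite !ffunE scalerDr !scalerA mulrC.
Qed.

HB.instance Definition _ (v : 'rV[K]_n) :=
  GRing.isLinear.Build K W (tensV n W) _ (tens v) (tens_is_linear v).
End Tens.

(** * An exchange relation in the Schur module *)

Section Garnir.
Variables (K : numFieldType) (n : nat) (rT B : finType) (row : B -> rT).
Implicit Types (T U : filling n B) (x y : B).
Local Notation cls := (@cls K n rT B row).

Lemma cls_row_equiv T U : row_equiv row T U -> cls T = cls U.
Proof.
move=> TU; apply/eqP; rewrite /Defs.cls vproj_eq.
apply: (subvP (addvSl _ _)); apply: (subvP (sumv_sup T _ (subvv _))) => //.
apply: (subvP (sumv_sup U _ (subvv _))) => //; exact: memv_line.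
Qed.

Lemma cls_Gsum (A : {set B}) T : (max_row_length row A < #|A|)%N ->
  \sum_(s : {perm B} | perm_on A s) cls (permute s T) = 0.
Proof.
move=> hA; rewrite -linear_sum /= -/(Gsum K A T) -[RHS](linear0 (vproj _)).
apply/eqP; rewrite vproj_eq subr0.
apply: (subvP (addvSr _ _)); apply: (subvP (sumv_sup A _ (subvv _))) => //.
apply: (subvP (sumv_sup T _ (subvv _))) => //; exact: memv_line.
Qed.

(** The relation G_A for A = y + (row s): the permutations of A that send y to a
    given x all give the class of the exchange of x and y, as they differ by
    permutations of row s.  Their number does not depend on x and is invertible
    in K, so that the exchanges of y with x, for x in A, sum to 0; the term x = y
    is the class of U itself. *)
Lemma garnir_swap (s : rT) y U : row y != s ->
  #|[set x | row x == row y]| = #|[set x | row x == s]| ->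
  \sum_(x | row x == s) cls (permute (tperm x y) U) = - cls U.
Proof.
move=> ys hc; set A := y |: [set x | row x == s].
have yA : y \in A by rewrite !inE eqxx.
have hA : (max_row_length row A < #|A|)%N.
  rewrite cardsU1 inE ys ltnS; apply/bigmax_leqP => x.
  by rewrite !inE => /orP[/eqP-> | /eqP->]; rewrite ?hc.
have := cls_Gsum U hA.
pose st r := perm_on A r && (r y == y).
have E x : x \in A -> \sum_(r | perm_on A r && (r y == x)) cls (permute r U) =
    cls (permute (tperm x y) U) *+ #|[pred r | st r]|.
  move=> xA; have pt : perm_on A (tperm x y).
    apply/subsetP => z; rewrite inE; case: tpermP => [->|->|] //.
    by move=> _ _; rewrite eqxx.
  (* r = r' * tperm x y with r' fixing y, and r' preserves the rows. *)
  rewrite (reindex_inj (mulIg (tperm x y))) /= -sumr_const.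
  apply: eq_big => [r|r].
    rewrite unfold_in /= /st permM.
    rewrite -[X in _ == X](tpermR x y) (inj_eq (@perm_inj _ _)).
    congr (_ && _); apply/idP/idP => hr; last exact: perm_onM.
    by rewrite -[r](mulgK (tperm x y)) tpermV perm_onM.
  move=> /andP[ron /eqP].
  rewrite permM -[in RHS](tpermR x y) => /perm_inj ry.
  have {}ron : perm_on A r.
    by rewrite -[r](mulgK (tperm x y)) tpermV perm_onM.
  apply/esym/cls_row_equiv/existsP; exists r; apply/andP; split; last first.
    by apply/eqP/ffunP => z; rewrite !ffunE permM.
  apply/forallP => z; have [zA|zA] := boolP (z \in A); last first.
    by rewrite (out_perm ron).
  have [->|zy] := eqVneq z y; first by rewrite ry.
  have : r z \in A by rewrite (perm_closed _ ron).
  move: zA; rewrite !inE (negPf zy) -{1}ry (inj_eq (@perm_inj _ _)) (negPf zy).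
  by move=> /= /eqP-> /eqP->.
rewrite (partition_big (fun r : {perm B} => r y) (mem A)) /=; last first.
  by move=> r ron; rewrite (perm_closed _ ron).
rewrite (eq_bigr _ E) sumrMnl -scaler_nat => /eqP.
rewrite scaler_eq0 pnatr_eq0.
case/orP => [/eqP c0|/eqP].
  have /card0_eq/(_ 1%g) := c0.
  by rewrite !inE /st perm_on1 perm1 eqxx.
rewrite big_setU1 ?inE //= tperm1 => /eqP.
have -> : permute 1 U = U by apply/ffunP => z; rewrite ffunE perm1.
rewrite addrC addr_eq0 => /eqP <-.
by apply: eq_bigl => x; rewrite inE.
Qed.
End Garnir.

(** * Rows and their order *)

Section Rows.
Variables (N : nat) (w h : nat -> nat).
Local Notation brow := (brow N h).
Local Notation box := (box N w h).
Implicit Types (r s : brow) (x y : box) (u v : option box).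

Lemma brow_eqP r s :
  reflect (tag r = tag s /\ tagged r = tagged s :> nat) (r == s).
Proof.
apply: (iffP eqP) => [->//|]; case: r s => b i [c j] /= [E].
by subst c => E; congr Tagged; apply: val_inj.
Qed.

(** The number of a row plus its height is the number of rows in its block and
    the higher ones; the sum of h is the k - j of Olver's denominators, up to the
    heights. *)
Lemma row_number_addl r s : (tag r <= tag s)%N ->
  (row_number r + tagged r =
   row_number s + tagged s + \sum_(tag r <= c < tag s) h c)%N.
Proof.
move=> rs; rewrite /row_number -!addnA !(addnA (_ - _)%N).
rewrite !subnK 1?ltnW ?ltn_ord //.
have big_lt (t : brow) : (\sum_((tag t).+1 <= c < N) h c + h (tag t) =
    \sum_(tag t <= c < N) h c)%N.
  by rewrite [in RHS]big_ltn // addnC.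
by rewrite addnA !big_lt addnC -big_cat_nat // ltnW.
Qed.

Lemma row_number_gt0 r : (0 < row_number r)%N.
Proof. by rewrite addn_gt0 subn_gt0 ltn_ord orbT. Qed.

Lemma row_number_ltE r s : (row_number s < row_number r)%N =
  (tag r < tag s)%N || (tag r == tag s) && (tagged r < tagged s)%N.
Proof.
have aux (t t' : brow) : (tag t < tag t')%N -> (row_number t' < row_number t)%N.
  move=> tt; have := row_number_addl (ltnW tt); rewrite big_ltn //.
  have := ltn_ord (tagged t); lia.
have [rs|sr|/val_inj rs] := ltngtP (tag r) (tag s); first exact: aux.
  by rewrite andbC ltnNge ltnW ?aux // -val_eqE (gtn_eqF sr) andbF.
have -> : tag r == tag s by rewrite rs.
have rs' : (tag r <= tag s)%N by rewrite rs.
have := row_number_addl rs'; rewrite [\sum_(_ <= _ < _) _]big_geq ?rs //; lia.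
Qed.

Lemma row_number_inj : injective (@row_number N h).
Proof.
move=> r s E; apply/eqP/brow_eqP.
have := row_number_ltE r s; have := row_number_ltE s r; rewrite E ltnn.
rewrite (eq_sym (tag s)).
case: (ltngtP (tag r) (tag s)) => //= /val_inj e; have -> : tag r == tag s by rewrite e.
by case: ltngtP.
Qed.

(** The order of boxes read as a reversed order of numbers, the extra box y_1
    getting 0 because rows are numbered from 1. *)
Definition rank u := if u is Some x then row_number (box_row x) else 0%N.

Lemma box_ltE u v : box_lt u v = (rank v < rank u)%N.
Proof.
case: u v => [x|] [y|]; rewrite /box_lt /= ?row_number_ltE //.
- by rewrite row_number_gt0 ltn_ord.
- by rewrite ltnNge ltnW // eq_sym (ltn_eqF (ltn_ord _)).
- by rewrite ltnn andbF.
Qed.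

Lemma box_leE u v : box_le u v = (rank v <= rank u)%N.
Proof.
case: u v => [x|] [y|]; rewrite /box_le /=.
- rewrite [RHS]leqNgt row_number_ltE negb_or negb_and.
  rewrite -!leqNgt (eq_sym (box_block y)) -val_eqE /=.
  by rewrite /box_block; case: (ltngtP (tag (tag x)) (tag (tag y))).
- by rewrite ltn_ord.
- rewrite [RHS]leqNgt row_number_gt0 ltnNge ltnW //=.
  by rewrite eq_sym (ltn_eqF (ltn_ord _)).
- by rewrite ltnn eqxx.
Qed.

Lemma rank_Some_gt0 x : (0 < rank (Some x))%N.
Proof. exact: row_number_gt0. Qed.

End Rows.

(** * Sets with one box in each of given rows *)

Section Choices.
Variables (N : nat) (w h : nat -> nat) (x1 : box N w h).
Local Notation brow := (brow N h).
Local Notation box := (box N w h).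
Local Notation rowof := (@box_row N w h).
Implicit Types (r s : brow) (x y : box) (u v : option box).
Implicit Types (R : {set box}) (S D : {set brow}).

(** The equality of cardinals makes the row map injective on R. *)
Definition selects S R := (rowof @: R == S) && (#|R| == #|S|).

Definition box_rank x := row_number (rowof x).

Definition chain R : seq box := sort (relpre box_rank leq) (enum R).

(** From the top to the bottom: y_1, then the boxes of R other than x_1, then x_1.
    Read cyclically, [prev] is the move of a 1-path along R, and [next] gives the
    box whose entry arrives.  Removing x_1 and putting it back at the end treats
    uniformly the cases where R contains x_1 or another box of its row. *)
Definition cyc R : seq (option box) :=
  None :: rcons (map Some (chain (R :\ x1))) (Some x1).

Lemma selects_inj S R : selects S R -> {in R &, injective rowof}.
Proof. by case/andP=> /eqP<-; rewrite eq_sym => /imset_injP. Qed.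

Lemma mem_chain R : chain R =i R.
Proof. by move=> x; rewrite mem_sort mem_enum. Qed.

Lemma chain_uniq R : uniq (chain R).
Proof. by rewrite sort_uniq enum_uniq. Qed.

Lemma cyc_uniq R : uniq (cyc R).
Proof.
rewrite /= rcons_uniq mem_rcons inE /= map_inj_uniq; last by move=> ? ? [].
rewrite chain_uniq mem_map ?mem_chain ?inE ?eqxx ?andbT; last by move=> ? ? [].
by apply/mapP => -[].
Qed.

Lemma mem_cyc R u :
  (u \in cyc R) = (u \in [set Some x | x in R] :|: [set Some x1] :|: [set None]).
Proof.
rewrite !inE mem_rcons inE; case: u => [x|]; last by rewrite orbT.
rewrite mem_map ?mem_chain ?inE ?mem_imset; try by move=> ? ? [].
by rewrite (inj_eq (@Some_inj _)) orbF orbC; case: eqP => //= ->; rewrite orbT.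
Qed.

Lemma chain_sorted R : {in R &, injective rowof} ->
  sorted ltn (map box_rank (chain R)).
Proof.
move=> injR; rewrite ltn_sorted_uniq_leq sorted_map sort_sorted ?andbT.
  rewrite map_inj_in_uniq ?chain_uniq // => x y; rewrite !mem_chain => xR yR.
  by move/row_number_inj; exact: injR.
by move=> x y; exact: leq_total.
Qed.

Lemma sorted_chainE R (c : seq box) :
  sorted ltn (map box_rank c) -> c =i R -> c = chain R.
Proof.
move=> sc cR.
have injR : {in R &, injective rowof}.
  have U := sorted_uniq ltn_trans ltnn sc.
  move=> x y; rewrite -!cR => xc yc exy; apply: (uniq_map_inj_in U) => //.
  by rewrite /box_rank exy.
apply: (@irr_sorted_eq _ (relpre box_rank ltn)) => [y x z|x|||].
- exact: ltn_trans.
- exact: ltnn.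
- by rewrite -sorted_map.
- by rewrite -sorted_map chain_sorted.
- by move=> x; rewrite cR mem_chain.
Qed.

Lemma chain_cat R s : {in R &, injective rowof} -> s \notin rowof @: R ->
  chain R = [seq x <- chain R | (box_rank x < row_number s)%N] ++
            [seq x <- chain R | (row_number s < box_rank x)%N].
Proof.
move=> injR sR; have := chain_sorted injR.
have : all (fun x => box_rank x != row_number s) (chain R).
  apply/allP => x; rewrite mem_chain => xR; apply: contraNneq sR.
  by move/row_number_inj <-; exact: imset_f.
elim: (chain R) => //= x c IH /andP[xs /IH{}IH] xc.
have {}IH := IH (path_sorted xc); case: ltngtP xs => // xs _ /=.
  by rewrite -IH.
suff e : [seq y <- c | (box_rank y < row_number s)%N] = [::].
  by rewrite {1}IH e.
apply/eqP; rewrite -[_ == _]negbK -has_filter; apply/hasPn => y yc.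
rewrite -leqNgt ltnW // (leq_trans xs) // ltnW //.
by move: xc; rewrite (path_sortedE ltn_trans) => /andP[/allP + _]; apply; rewrite map_f.
Qed.

Lemma chain_insert R x : {in R &, injective rowof} -> rowof x \notin rowof @: R ->
  chain (x |: R) = [seq y <- chain R | (box_rank y < box_rank x)%N] ++
              x :: [seq y <- chain R | (box_rank x < box_rank y)%N].
Proof.
move=> injR xR; apply/esym/sorted_chainE; last first.
  move=> y; rewrite !inE -(mem_chain R) {3}(chain_cat injR xR).
  by rewrite !mem_cat inE orbCA.
rewrite map_cat /= -cat1s catA cats1.
have := chain_sorted injR; set c := chain R => sc.
rewrite (sorted_pairwise ltn_trans) pairwise_cat pairwise_rcons.
have pf p : pairwise ltn [seq box_rank y | y <- c & p y].
  rewrite -(sorted_pairwise ltn_trans) sorted_map.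
  by apply: sorted_filter; [move=> ? ? ?; exact: ltn_trans|rewrite -sorted_map].
rewrite !pf !andbT; apply/andP; split; last first.
  by apply/allP => _ /mapP[y + ->]; rewrite mem_filter => /andP[].
apply/allrelP => a b; rewrite mem_rcons inE => ha /mapP[y + ->] {b}.
rewrite mem_filter => /andP[xy _]; case/predU1P: ha => [->//|].
by case/mapP=> z + ->; rewrite mem_filter => /andP[/ltn_trans-> //].
Qed.

End Choices.

(** * Sliding entries, and adding a row *)

Section Slide.
Variables (N : nat) (w h : nat -> nat) (x1 : box N w h).
Local Notation brow := (brow N h).
Local Notation box := (box N w h).
Local Notation rbox := (rbox x1).
Local Notation rowof := (@box_row N w h).
Local Notation rrow := (@rbox_row N w h x1).
Implicit Types (r s : brow) (x y : box) (u v : option box).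
Implicit Types (R : {set box}) (S D : {set brow}).

Lemma sum_rbox (M : nmodType) s (F : box -> M) : s != rowof x1 ->
  \sum_(x | rowof x == s) F x = \sum_(y : rbox | rrow y == s) F (val y).
Proof.
move=> sx1; rewrite (reindex_omap (val : rbox -> box) insub) => [|x /eqP xs].
  by apply: eq_bigl => y; rewrite valK eqxx andbT.
by rewrite insubT //; apply: contra_neq sx1 => <-; rewrite xs.
Qed.

Lemma card_rrow s : s != rowof x1 -> #|[set y : rbox | rrow y == s]| = w (tag s).
Proof.
move=> sx1; rewrite -sum1_card; under eq_bigl do rewrite inE.
rewrite -(sum_rbox (fun=> 1%N)) //.
rewrite -[RHS]card_ord -sum1_card.
rewrite (eq_bigl (fun x : box => (pred1 s) (tag x) && true)) => [|x]; last first.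
  by rewrite andbT.
rewrite -(sig_big_dep _ (fun r => xpredT) (fun r i => 1%N)) /=.
by rewrite big_pred1_eq.
Qed.

Variables (K : numFieldType) (n : nat).
Implicit Types T : filling n box.

(** The default value x1 is never reached: the box after [Some y] in [cyc] is not
    [None], because only x_1 precedes y_1 cyclically. *)
Definition slide_filling R T : filling n rbox :=
  [ffun y : rbox => T (odflt x1 (next (cyc x1 R) (Some (val y))))].

Definition slide R T : tensV n (Smu K n x1) :=
  tens (e_ (T (odflt x1 (next (cyc x1 R) None)))) (cls K rrow (slide_filling R T)).

Hypothesis x1_low : tagged (rowof x1) = 0%N :> nat.

(** If y is the box of R next above row s, then inserting a box x of row s into R
    exchanges the entries of x and y in the result, and changes neither the other
    entries nor the outgoing one.  Row s and the row of y have the same length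
    since r bounds y from above inside the block of s, so [garnir_swap] sums
    over x. *)
Lemma slide_insert S R T r s : selects S R -> rowof x1 \in S ->
  s \notin S -> r \in S -> tag r == tag s -> (tagged s < tagged r)%N ->
  \sum_(x | rowof x == s) slide (x |: R) T = - slide R T.
Proof.
move=> selR x1S sS rS rs lt_sr; have injR := selects_inj selR.
have rowR : rowof @: R = S by case/andP: selR => /eqP.
have sx1 : s != rowof x1 by apply: contraNneq sS => ->.
set R0 := R :\ x1.
have injR0 : {in R0 &, injective rowof}.
  by move=> x y /setD1P[_ xR] /setD1P[_ yR]; exact: injR.
have sR0 : s \notin rowof @: R0.
  by apply: contra sS; rewrite -rowR; apply/subsetP/imsetS/subD1set.
have rks : (row_number r < row_number s)%N.
  by rewrite row_number_ltE (eq_sym (tag s)) rs lt_sr orbT.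
have : exists2 y, y \in R0 & rowof y = r.
  move: rS; rewrite -rowR => /imsetP[y yR ry]; exists y => //.
  rewrite !inE yR andbT; apply: contraTneq lt_sr => yx1.
  by rewrite ry yx1 x1_low.
case=> y0 y0R ry0.
(* p holds the boxes of R0 above row s, and y will be its last element. *)
set p := [seq x <- chain R0 | (box_rank x < row_number s)%N].
set q := [seq x <- chain R0 | (row_number s < box_rank x)%N].
have chR0 : chain R0 = p ++ q by exact: chain_cat.
have y0p : y0 \in p by rewrite mem_filter mem_chain y0R /box_rank ry0 rks.
have [p' [y defp]] : exists p' y, p = rcons p' y.
  by case: (lastP p) y0p => // p' y _; exists p', y.
rewrite defp in y0p chR0.
have /andP[lt_ys yR0] : (box_rank y < row_number s)%N && (y \in R0).
  have : y \in p by rewrite defp mem_rcons mem_head.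
  by rewrite mem_filter mem_chain.
have le_ry : (row_number r <= box_rank y)%N.
  have := chain_sorted injR0; rewrite chR0 map_cat map_rcons cat_rcons.
  rewrite (sorted_pairwise ltn_trans) pairwise_cat => /andP[/allrelP lt_y _].
  rewrite -ry0; move: y0p; rewrite mem_rcons inE => /predU1P[->//|y0p].
  exact: ltnW (lt_y _ _ (map_f (@box_rank N w h) y0p) (mem_head _ _)).
(* y lies between r and s, two rows of one block. *)
have tag_y : tag (rowof y) = tag s.
  apply: val_inj; apply/eqP; rewrite eqn_leq.
  move: le_ry lt_ys; rewrite leqNgt /box_rank !row_number_ltE negb_or.
  rewrite -leqNgt; move/eqP: (rs) => {1}-> => /andP[-> _] /orP[/ltnW//|].
  by move=> /andP[/eqP e _]; rewrite e /= leqnn.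
have row_ys : rowof y != s by apply: contraTneq lt_ys => <-; rewrite ltnn.
have row_yx1 : rowof y != rowof x1.
  apply: contraTneq lt_ys => yx1; rewrite /box_rank -leqNgt leqNgt.
  by rewrite yx1 row_number_ltE x1_low ltn0 andbF -yx1 tag_y ltnn.
have yx1 : y != x1 by case/setD1P: yR0.
have cyR : cyc x1 R = (None :: map Some p') ++
    Some y :: rcons (map Some q) (Some x1).
  by rewrite /cyc -/R0 chR0 cat_rcons map_cat rcons_cat.
have cyRx x : rowof x == s -> cyc x1 (x |: R) = (None :: map Some p') ++
    [:: Some y, Some x & rcons (map Some q) (Some x1)].
  move=> /eqP xs; rewrite /cyc.
  have -> : (x |: R) :\ x1 = x |: R0.
    rewrite setDUl; congr (_ :|: _); apply/setDidPl; rewrite disjoints1 inE.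
    by apply: contra_neq sx1 => <-; rewrite xs.
  rewrite chain_insert ?xs // /box_rank xs -/(box_rank _) -/p -/q defp.
  by rewrite cat_rcons map_cat rcons_cat.
pose y' : rbox := Sub y yx1.
rewrite /slide -linearN.
rewrite -(@garnir_swap K n _ _ rrow s y' (slide_filling R T)) //; last first.
  by rewrite !card_rrow // [rrow y']/(rowof y) tag_y.
rewrite linear_sum sum_rbox //; apply: eq_bigr => x xs.
have cx := cyRx _ xs; have Ux := cyc_uniq x1 (val x |: R); rewrite cx in Ux.
have nx u : next (cyc x1 (val x |: R)) u =
    next (cyc x1 R) (tperm (Some (val x)) (Some y) u).
  by rewrite cx cyR next_insert.
rewrite nx tpermD //; congr (tens _ (cls _ _ _)).
apply/ffunP => z; rewrite !ffunE nx; congr (T (odflt _ (next _ _))).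
rewrite -[Some y]/(Some (val y')).
have val_inj' : injective (fun u : rbox => Some (val u)).
  by move=> a c [] /val_inj.
by rewrite -(inj_tperm _ _ _ val_inj').
Qed.
End Slide.

(** * Closing a set of rows downwards inside blocks *)

Section Closure.
Variables (N : nat) (h : nat -> nat).
Implicit Types (r s : brow N h) (S D : {set brow N h}).

Definition down_closure S : {set brow N h} :=
  [set r : brow N h | [exists s in S, (tag s == tag r) && (tagged r <= tagged s)%N]].

Lemma down_closureP S r :
  reflect (exists s, [/\ s \in S, tag s == tag r & (tagged r <= tagged s)%N])
          (r \in down_closure S).
Proof.
rewrite inE; apply: (iffP exists_inP) => -[s].
  by move=> sS /andP[e l]; exists s.
by case=> sS e l; exists s; rewrite ?e.
Qed.

Lemma sub_down_closure S : S \subset down_closure S.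
Proof. by apply/subsetP => r rS; apply/down_closureP; exists r. Qed.

Lemma down_closureS S D : S \subset D -> down_closure S \subset down_closure D.
Proof.
move=> /subsetP SD; apply/subsetP => r /down_closureP[s [/SD sD e l]].
by apply/down_closureP; exists s.
Qed.

Lemma down_closureK S : down_closure (down_closure S) = down_closure S.
Proof.
apply/eqP; rewrite eqEsubset sub_down_closure andbT.
apply/subsetP => r /down_closureP[s [/down_closureP[t [tS e l]] e' l']].
apply/down_closureP; exists t; split=> //; last exact: leq_trans l' l.
by apply/eqP; rewrite (eqP e) (eqP e').
Qed.

(** The missing rows of the closure can be added one at a time, each one below a
    row already present, and each addition changes both the sign of F and the
    parity of the cardinal.  The row r0 is kept as a condition because the
    exchange relation is only available for sets that contain the row of x_1. *)
Lemma alternating_down_closure (K : pzRingType) (M : lmodType K)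
    (F : {set brow N h} -> M) r0 :
  (forall S r s, r0 \in S -> s \notin S -> r \in S -> tag r == tag s ->
     (tagged s < tagged r)%N -> F (s |: S) = - F S) ->
  forall S, r0 \in S ->
  (-1) ^+ #|down_closure S| *: F (down_closure S) = (-1) ^+ #|S| *: F S.
Proof.
move=> F_insert S; have [m lt_m] := ubnP #|down_closure S :\: S|.
elim: m => // m IH in S lt_m *; rewrite ltnS in lt_m => r0S.
have [e|[s /setDP[sC sS]]] := set_0Vmem (down_closure S :\: S).
  suff -> : down_closure S = S by [].
  by apply/eqP; rewrite eqEsubset sub_down_closure -setD_eq0 e eqxx.
have /down_closureP[r [rS rs le_sr]] := sC.
have lt_sr : (tagged s < tagged r)%N.
  rewrite ltn_neqAle le_sr andbT; apply: contraNneq sS => E.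
  suff /eqP-> : s == r by [].
  by apply/brow_eqP; split=> //; apply/esym/eqP.
have eC : down_closure (s |: S) = down_closure S.
  apply/eqP; rewrite eqEsubset (down_closureS (subsetUr _ _)) andbT.
  have := @down_closureS (s |: S) (down_closure S); rewrite down_closureK.
  by apply; rewrite subUset sub1set sC sub_down_closure.
rewrite -eC IH; first last.
- by rewrite inE r0S orbT.
- rewrite eC setUC -setDDl (leq_trans _ lt_m) //.
  by rewrite [X in (_ < X)%N](cardsD1 s) in_setD sC sS.
rewrite (F_insert _ _ _ r0S sS rS rs lt_sr) cardsU1 sS.
by rewrite exprS mulN1r scaleNr scalerN opprK.
Qed.

End Closure.

Section Alternation.
Variables (N : nat) (w h : nat -> nat) (x1 : box N w h).
Local Notation brow := (brow N h).
Local Notation box := (box N w h).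
Local Notation rowof := (@box_row N w h).
Implicit Types (r s : brow) (x y : box) (R : {set box}) (S D : {set brow}).
Variables (K : numFieldType) (n : nat) (T : filling n box).
Hypothesis x1_low : tagged (rowof x1) = 0%N :> nat.

Definition slide_rows S : tensV n (Smu K n x1) :=
  \sum_(R | selects S R) slide x1 K R T.

Lemma selects_insert S s R x : selects S R -> s \notin S -> rowof x = s ->
  selects (s |: S) (x |: R).
Proof.
move=> /andP[/eqP SR /eqP c] sS xs.
have xR : x \notin R by apply: contra sS => xR; rewrite -SR -xs imset_f.
by rewrite /selects imsetU1 SR xs eqxx !cardsU1 sS xR c eqxx.
Qed.

Lemma selects_remove S s R x : selects (s |: S) R -> s \notin S -> x \in R ->
  rowof x = s -> selects S (R :\ x).
Proof.
move=> selR sS xR xs; have injR := selects_inj selR.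
case/andP: selR => /eqP SR /eqP c; apply/andP; split; last first.
  by move: c; rewrite (cardsD1 x) xR cardsU1 sS => /addnI/eqP.
apply/eqP/setP => r; apply/imsetP/idP => [[y /setD1P[yx yR] ->{r}]|rS].
  have : rowof y \in s |: S by rewrite -SR imset_f.
  rewrite !inE => /orP[/eqP ys|//]; case/eqP: yx; apply: injR => //.
  by rewrite ys.
have /imsetP[y yR ry] : r \in rowof @: R by rewrite SR !inE rS orbT.
exists y => //; rewrite !inE yR andbT; apply: contraNneq sS => yx.
by rewrite -xs -yx -ry.
Qed.

(** A set with rows s + S is a set R with rows S together with a box of row s, so
    that [slide_insert] applies term by term. *)
Lemma slide_rows_insert S r s : rowof x1 \in S -> s \notin S -> r \in S ->
  tag r == tag s -> (tagged s < tagged r)%N -> slide_rows (s |: S) = - slide_rows S.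
Proof.
move=> x1S sS rS rs lt_sr; rewrite /slide_rows -sumrN.
pose D := [set p : {set box} * box | selects S p.1 & rowof p.2 == s].
pose ins (p : {set box} * box) := p.2 |: p.1.
have notin p : p \in D -> p.2 \notin p.1.
  case: p => R x; rewrite inE /= => /andP[/andP[/eqP SR _] /eqP xs].
  by apply: contra sS => xR; rewrite -SR -xs imset_f.
have insI : {in D &, injective ins}.
  move=> [R x] [R' x'] p p' /= e.
  have := notin _ p; have := notin _ p'; rewrite /= => xR' xR.
  move: p p'; rewrite !inE /= => /andP[sR /eqP xs] /andP[sR' /eqP xs'].
  have xx : x = x'.
    apply: (selects_inj (selects_insert sR sS xs)); rewrite ?setU11 ?xs //.
    by rewrite -/(ins (R, x)) e setU11.
  rewrite /ins /= -xx in e; rewrite -xx in xR'; congr pair => //.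
  by rewrite -(setU1K xR) e setU1K.
rewrite (eq_bigl (mem (ins @: D))) => [|R]; last first.
  apply/idP/imsetP => [sR|[[R' x] /[!inE] /andP[sR' /eqP xs] ->]]; last first.
    exact: selects_insert.
  have /imsetP[x xR sx] : s \in rowof @: R.
    by case/andP: sR => /eqP-> _; rewrite setU11.
  exists (R :\ x, x); rewrite ?inE /ins /= ?setD1K // -sx eqxx andbT.
  exact: selects_remove sR _ _ _.
rewrite big_imset //=.
rewrite (eq_bigl (fun p => selects S p.1 && (rowof p.2 == s))); last first.
  by move=> p; rewrite inE.
rewrite -(pair_big_dep _ (fun R x => rowof x == s) (fun R x => slide x1 K (x |: R) T)) /=.
by apply: eq_bigr => R sR; exact: (@slide_insert _ _ _ _ K n x1_low S R T r s).
Qed.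

End Alternation.

(** * Olver's denominators *)

Section Interval.
Variables (N : nat) (h : nat -> nat) (r0 : brow N h).
Implicit Types (r s : brow N h) (S D : {set brow N h}).

(** The rows that belong to every S containing r0 whose closure is D: besides r0,
    the top row of D in each block. *)
Definition forced_rows D : {set brow N h} :=
  [set r in D | (r == r0) ||
    [forall s in D, (tag s == tag r) ==> (tagged s <= tagged r)%N]].

Lemma exists_top D r : r \in D -> exists s, [/\ s \in D, tag s == tag r &
  forall t, t \in D -> tag t == tag r -> (tagged t <= tagged s)%N].
Proof.
move=> rD.
pose P (s : brow N h) := (s \in D) && (tag s == tag r).
have Pr : P r by rewrite /P rD eqxx.
case: (@arg_maxnP _ r P (fun s => tagged s) Pr) => s /andP[sD sr] max_s.
by exists s; split=> // t tD tr; apply: max_s; rewrite /P tD.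
Qed.

(** The sets with a given closure form an interval for inclusion, which turns the
    sum over them into a product. *)
Lemma down_closure_eqE D S : down_closure D = D -> r0 \in D ->
  (r0 \in S) && (down_closure S == D) = (forced_rows D \subset S) && (S \subset D).
Proof.
move=> clD r0D; apply/andP/andP => [[r0S /eqP clS]|[MS SD]].
  have SD : S \subset D by rewrite -clS sub_down_closure.
  split=> //; apply/subsetP => r; rewrite inE => /andP[rD /orP[/eqP->//|top]].
  move: (rD); rewrite -clS => /down_closureP[s [sS sr le_rs]].
  have /forall_inP/(_ s (subsetP SD s sS)) := top.
  rewrite sr /= => le_sr; suff /eqP-> : r == s by [].
  by apply/brow_eqP; split; [apply/esym/eqP | apply/eqP; rewrite eqn_leq le_rs].
split; first by apply: (subsetP MS); rewrite inE r0D eqxx.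
rewrite eqEsubset -{1}clD down_closureS //=; apply/subsetP => r rD.
have [s [sD sr max_s]] := exists_top rD.
apply/down_closureP; exists s; split=> //; last exact: max_s.
apply: (subsetP MS); rewrite inE sD; apply/orP; right.
by apply/forall_inP => t tD; apply/implyP => ts; apply: max_s; rewrite // (eqP ts).
Qed.

End Interval.

Section Coefficient.
Variables (N : nat) (w h : nat -> nat) (x1 : box N w h).
Hypothesis hblocks : block_form N w h.
Local Notation brow := (brow N h).
Local Notation r0 := (box_row x1).
Local Notation b1 := (box_block x1).
Hypothesis x1_low : tagged r0 = 0%N :> nat.
Variable K : numFieldType.
Implicit Types (r s : brow) (S D : {set brow}).

(** This is H(b) + i as a natural number; the subtraction is not truncated for
    the blocks b >= b1 considered below. *)
Definition gap (b i : nat) : nat :=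
  (w b - w b1 + \sum_((b1 : nat) <= c < b) h c + i)%N.

(** Olver's factor of the row at height i in the block b.  The row of x_1 has no
    factor in c_J, whereas its gap is 0; the value 1 fits the telescoping product
    of its block, in which the height 1 also has weight 1. *)
Definition weight (b i : nat) : K :=
  if (b == b1) && (i == 0%N) then 1 else (gap b i)%:R.

Lemma w_mono (b : 'I_N) : (b1 <= b)%N -> (w b1 <= w b)%N.
Proof.
case: hblocks => _ wlt _; rewrite leq_eqVlt => /predU1P[/val_inj->//|lt].
exact/ltnW/wlt.
Qed.

Lemma gap_gt0 (b : 'I_N) i : (b1 <= b)%N -> ~~ ((b == b1) && (i == 0%N)) ->
  (0 < gap b i)%N.
Proof.
rewrite leq_eqVlt => /predU1P[/val_inj<-|lt _].
  by rewrite eqxx -lt0n /gap => i0; rewrite addn_gt0 i0 orbT.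
case: hblocks => _ /(_ _ _ lt (ltn_ord b)) wlt _.
by rewrite /gap -addnA addn_gt0 subn_gt0 wlt.
Qed.

Lemma weight_neq0 (b : 'I_N) i : (b1 <= b)%N -> weight b i != 0.
Proof.
move=> b1b; rewrite /weight; case: ifPn => [_|]; first exact: oner_neq0.
by move=> /(gap_gt0 b1b); rewrite pnatr_eq0 lt0n.
Qed.

Lemma weightS (b : 'I_N) i : ~~ ((b == b1) && (i == 0%N)) ->
  weight b i.+1 = weight b i + 1.
Proof.
move=> bi; rewrite /weight andbF (negPf bi) /gap addnS.
by rewrite -[(_.+1)%:R]natr1.
Qed.

Lemma weight_b11 : weight b1 1 = 1.
Proof. by rewrite /weight andbF /gap subnn big_geq. Qed.

Lemma Hblock_gap (b : 'I_N) : (b1 <= b)%N -> Hblock K x1 b = (gap b 0)%:R.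
Proof.
move=> b1b; rewrite /Hblock /gap addn0 natrD natrB ?w_mono //.
rewrite -(subnKC b1b); elim: (b - b1)%N => [|d IH].
  by rewrite addn0 !big_geq // subrr addr0.
rewrite addnS big_nat_recr /=; last by rewrite ltnS leq_addr.
rewrite IH big_nat_recr ?leq_addr //= natrD; ring.
Qed.

Lemma prod_weight_ratio (b : 'I_N) m : (b1 <= b)%N ->
  \prod_(i < m) (weight b i.+1 / weight b i) = weight b m / weight b 0.
Proof.
move=> b1b; elim: m => [|m IH]; first by rewrite big_ord0 divff ?weight_neq0.
by rewrite big_ord_recr /= IH mulrC mulrA divfK ?weight_neq0.
Qed.

(** With v(i) for the weights and m for the top height of D in the block, the
    factor of a free row is 1/v(i) + 1 = v(i+1)/v(i) and that of the top row is
    1/v(m).  The row of x_1 is forced, but its factor 1/v(0) = 1 equals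
    v(1)/v(0), so the product telescopes to 1/v(0) in every block. *)
Lemma prod_block D (b : 'I_N) : down_closure D = D -> r0 \in D -> (b1 <= b)%N ->
  (exists r, (r \in D) && (tag r == b)) ->
  \prod_(r in D | tag r == b) ((weight (tag r) (tagged r))^-1 +
     (r \notin forced_rows r0 D)%:R) = (weight b 0)^-1.
Proof.
move=> clD r0D b1b [r1 /andP[r1D /eqP r1b]].
have [s [sD sr1 max_s]] := exists_top r1D.
case: s => c m in sD sr1 max_s *; rewrite /= {}r1b in sr1 max_s.
move/eqP: sr1 => /= cb; subst c.
pose tg (c : 'I_N) (i : 'I_(h c)) : brow := Tagged (fun b : 'I_N => 'I_(h b)) i.
have tgD i : (tg b i \in D) = (i <= m)%N.
  apply/idP/idP => [/max_s/(_ (eqxx _))//|le_im].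
  by rewrite -clD; apply/down_closureP; exists (tg b m).
rewrite (eq_bigl (fun r => (tag r == b) && (tg (tag r) (tagged r) \in D))); last first.
  by case=> c i; rewrite andbC.
rewrite (eq_bigr (fun r => (weight (tag r) (tagged r))^-1 +
    (tg (tag r) (tagged r) \notin forced_rows r0 D)%:R)) => [|[c i] _ //].
rewrite -(sig_big_dep (J := fun c : 'I_N => 'I_(h c)) (pred1 b)
  (fun c j => tg c j \in D)
  (fun c j => (weight c j)^-1 + (tg c j \notin forced_rows r0 D)%:R)) /=.
rewrite big_pred1_eq.
have top (i : 'I_(h b)) : (i <= m)%N -> (tg b i \in forced_rows r0 D) =
    ((b == b1) && (i == 0%N :> nat)) || (i == m).
  move=> le_im; rewrite inE tgD le_im /=; congr (_ || _).
    apply/brow_eqP/andP => /= -[e1 e2]; last first.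
      by split; [exact/eqP | rewrite x1_low; exact/eqP].
    by split; apply/eqP; rewrite // e2 x1_low.
  apply/forall_inP/eqP => [/(_ (tg b m))|-> t tD].
    rewrite tgD leqnn eqxx /= => /(_ isT) le_mi.
    by apply/val_inj/eqP; rewrite eqn_leq le_im.
  by apply/implyP => tb; apply: max_s.
rewrite (eq_bigl (fun i : 'I_(h b) => (i < m.+1)%N)); last exact: tgD.
rewrite (eq_bigr (fun i : 'I_(h b) =>
   if (i < m)%N then weight b i.+1 / weight b i else (weight b i)^-1)); last first.
  move=> i; rewrite ltnS => le_im; rewrite top // -[i == m]val_eqE /= negb_or.
  move: le_im; rewrite leq_eqVlt => /predU1P[/val_inj->|lt_im].
    by rewrite eqxx ltnn andbF addr0.
  rewrite lt_im (ltn_eqF lt_im) andbT.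
  have [/andP[/eqP bb1 /eqP i0]|bi] := boolP (_ && _).
    rewrite i0 (congr1 val bb1 : b = b1 :> nat).
    by rewrite weight_b11 /= addr0 /weight !eqxx invr1 mulr1.
  by rewrite weightS // mulrDl divff ?weight_neq0 // mul1r addrC.
rewrite -(big_ord_widen _ (fun i =>
  if (i < m)%N then weight b i.+1 / weight b i else (weight b i)^-1)) //.
rewrite big_ord_recr /= ltnn.
rewrite (eq_bigr (fun i : 'I_m => weight b i.+1 / weight b i)) => [|i _]; last first.
  by rewrite ltn_ord.
by rewrite prod_weight_ratio // mulrAC divff ?weight_neq0 // mul1r.
Qed.

(** For b > b1 the weight v(0) of the block b is H(b), and it is 1 for b = b1. *)
Lemma sum_weights D : down_closure D = D -> r0 \in D ->
  {in D, forall r, (b1 <= tag r)%N} ->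
  \sum_(S : {set brow} | (r0 \in S) && (down_closure S == D))
    \prod_(r in S) (weight (tag r) (tagged r))^-1 =
  (\prod_(b < N | (b1 < b)%N && [exists r in D, tag r == b]) Hblock K x1 b)^-1.
Proof.
move=> clD r0D D_b1; rewrite (eq_bigl _ _ (fun S => down_closure_eqE S clD r0D)).
rewrite sum_subset_interval; last by apply/subsetP => r /setIdP[].
rewrite (partition_big (fun r : brow => tag r) xpredT) //= -prodfV [RHS]big_mkcond /=.
apply: eq_bigr => b _.
have [/exists_inP[r rD rb]|noD] := boolP [exists r in D, tag r == b].
  have b1b : (b1 <= b)%N by rewrite -(eqP rb) D_b1.
  rewrite andbT prod_block //; last by exists r; rewrite rD.
  rewrite /weight eqxx andbT Hblock_gap // ltn_neqAle b1b andbT eq_sym.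
  by case: eqVneq => //; rewrite invr1.
rewrite andbF big_pred0 // => r; apply: contraNF noD => /andP[rD rb].
by apply/exists_inP; exists r.
Qed.

End Coefficient.

(** * Olver's map as a sum over routes *)

Section Olver.
Variables (N : nat) (w h : nat -> nat) (x1 : box N w h).
Hypothesis hblocks : block_form N w h.
Local Notation brow := (brow N h).
Local Notation box := (box N w h).
Local Notation rowof := (@box_row N w h).
Local Notation r0 := (box_row x1).
Local Notation b1 := (box_block x1).
Local Notation k := (row_number r0).
Hypothesis x1_low : tagged r0 = 0%N :> nat.
Variables (K : numFieldType) (n : nat).
Implicit Types (r s : brow) (x y : box) (R : {set box}) (S D : {set brow}).
Implicit Types T : filling n box.

Lemma row_number_le_r0 r : (row_number r <= k)%N = (b1 <= tag r)%N.
Proof.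
by rewrite leqNgt row_number_ltE x1_low ltn0 andbF orbF -leqNgt.
Qed.

Definition admissible S := (r0 \in S) && [forall r in S, b1 <= tag r]%N.

Lemma weight_row_number r : (b1 <= tag r)%N ->
  weight x1 K (tag r) (tagged r) =
  if (row_number r < k)%N then
    (lam N w h (row_number r))%:R - (lam N w h k)%:R + k%:R - (row_number r)%:R
  else 1.
Proof.
move=> b1r; have e := row_number_addl b1r; rewrite x1_low addn0 in e.
rewrite ltn_neqAle row_number_le_r0 b1r andbT !lam_row_number /weight.
have -> : (tag r == b1 :> nat) && (tagged r == 0%N :> nat) = (row_number r == k).
  rewrite (inj_eq (@row_number_inj N h)); apply/andP/brow_eqP => -[].
    by move=> /eqP e1 /eqP e2; rewrite x1_low; split=> //; apply: val_inj.
  by move=> e1 e2; split; apply/eqP; [rewrite e1 | rewrite e2 x1_low].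
case: eqP => //= _; rewrite e /gap !natrD natrB; last exact: w_mono hblocks _ _.
by ring.
Qed.

Lemma odflt_next_None (d : seq box) :
  odflt x1 (next (None :: rcons (map Some d) (Some x1)) None) = nth x1 d 0.
Proof. by case: d. Qed.

Lemma odflt_next_Some (d : seq box) y : y != x1 ->
  odflt x1 (next (None :: rcons (map Some d) (Some x1)) (Some y)) =
  if y \in d then nth x1 d (index y d).+1 else y.
Proof.
move=> yx1; rewrite next_nth inE /= mem_rcons inE (inj_eq (@Some_inj _)).
rewrite (negPf yx1) /= mem_map; last exact: Some_inj.
case: ifP => //= yd; rewrite -cats1 index_cat mem_map; last exact: Some_inj.
rewrite yd index_map; last exact: Some_inj.
rewrite nth_cat size_map; case: ltngtP (yd); rewrite -index_mem.
- by move=> lt _; rewrite (nth_map x1).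
- by rewrite ltnNge => /negPf->.
by move=> e _; rewrite e subnn /= nth_default // e.
Qed.

(** The last box of c lies in the row of x_1.  Either it is x_1, or it receives
    the entry of x_1 by the default value of [nth]; in both cases dropping x_1
    from c does not change [nth x1 c], so that the two fillings agree. *)
Lemma tens_shift_filling p (c : p.+1.-tuple box) T :
  sorted ltn (map (@box_rank N w h) c) -> last 0%N (map (@box_rank N w h) c) = k ->
  tens (e_ (T (thead c))) (cls K (@rbox_row N w h x1) (shift_filling x1 c T)) =
  slide x1 K [set x in c] T.
Proof.
move=> sc lc; set R := [set x in c]; set d := [seq x <- c | x != x1].
have dE : chain (R :\ x1) = d.
  apply/esym/sorted_chainE; last by move=> x; rewrite mem_filter !inE.
  rewrite sorted_map; apply: sorted_filter; first by move=> ? ? ?; exact: ltn_trans.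
  by rewrite -sorted_map.
have dc : c = rcons d x1 :> seq _ \/ d = c.
  case: (lastP c) (size_tuple c) @d sc lc dE => // c' z _ d sc lc dE.
  have c'x1 : [seq x <- c' | x != x1] = c'.
    apply/all_filterP/allP => x xc'; apply: contraTneq sc => xx1.
    rewrite map_rcons last_rcons in lc.
    rewrite map_rcons (sorted_pairwise ltn_trans) pairwise_rcons negb_and.
    apply/orP; left; apply/allPn; exists k; last by rewrite lc ltnn.
    by rewrite -xx1 (map_f (@box_rank N w h)).
  by rewrite /d filter_rcons c'x1; case: eqVneq => [->|_]; [left|right].
have nth_cd i : nth x1 c i = nth x1 d i.
  have [->|->] := dc => //; rewrite nth_rcons; case: ltnP => // le_di.
  by rewrite if_same nth_default.
have index_cd y : y \in d -> index y c = index y d.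
  by have [->|->] := dc => // yd; rewrite -cats1 index_cat yd.
have mem_cd y : y != x1 -> (y \in d) = (y \in c).
  by move=> yx1; rewrite mem_filter yx1.
rewrite /slide /slide_filling /cyc dE odflt_next_None.
congr (tens (e_ (T _)) (cls _ _ _)).
  by rewrite -nth_cd /thead (tnth_nth x1).
apply/ffunP => y; rewrite !ffunE; cbv zeta.
rewrite odflt_next_Some ?(valP y) // mem_cd ?(valP y) //.
have [yc|yc] := boolP (val y \in c).
  have yd : val y \in d by rewrite (mem_cd _ (valP y)).
  rewrite -nth_cd -index_cd //; have := yc; rewrite -index_mem size_tuple ltnS.
  rewrite leq_eqVlt => /predU1P[->|lt]; last by rewrite ltnS lt.
  by rewrite ltnn eqxx nth_default // size_tuple.
by rewrite (memNindex yc) size_tuple ltnNge leqnSn /= eqSS gtn_eqF.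
Qed.

(** An evacuation route without the condition that it fills a block from below;
    the rows are those that Olver's chains J may use. *)
Definition is_route R := (#|rowof @: R| == #|R|) && admissible (rowof @: R).

Definition route_weight R : K :=
  \prod_(r in rowof @: R) (weight x1 K (tag r) (tagged r))^-1.

Lemma routeP R : reflect
  [/\ {in R &, injective rowof}, r0 \in rowof @: R &
      {in R, forall x, (box_rank x <= k)%N}] (is_route R).
Proof.
apply: (iffP and3P) => [[/imset_injP injR r0R /forall_inP le]|[injR r0R le]].
  by split=> // x xR; rewrite /box_rank row_number_le_r0 le ?imset_f.
split=> //; first exact/imset_injP.
apply/forall_inP => _ /imsetP[x xR ->]; rewrite -row_number_le_r0; exact: le.
Qed.

Lemma chain_last R : is_route R -> last 0%N (map (@box_rank N w h) (chain R)) = k.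
Proof.
case/routeP => injR /imsetP[x xR rx] le.
have := chain_sorted injR; have := mem_chain R.
case/lastP: (chain R) => [/(_ x)|c z memR]; first by rewrite xR.
rewrite map_rcons last_rcons (sorted_pairwise ltn_trans) pairwise_rcons.
case/andP => /allP lt_z _; apply/eqP.
rewrite eqn_leq le -?memR ?mem_rcons ?mem_head //=.
have : x \in rcons c z by rewrite memR.
rewrite rx mem_rcons inE => /predU1P[->//|xc].
by apply/ltnW/lt_z/map_f.
Qed.

Lemma card_route R : is_route R -> (0 < #|R| <= k)%N.
Proof.
case/routeP => injR /imsetP[x xR _] le; apply/andP; split.
  by apply/card_gt0P; exists x.
rewrite cardE -(size_map (@box_rank N w h)) -[leqRHS](size_iota 1 k).
apply: uniq_leq_size => [|_ /mapP[y + ->]].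
  rewrite map_inj_in_uniq ?enum_uniq // => y z; rewrite !mem_enum => yR zR.
  by move/row_number_inj; exact: injR.
by rewrite mem_enum mem_iota add1n ltnS row_number_gt0 => /le.
Qed.

Lemma size_chain R : size (chain R) = #|R|.
Proof. by rewrite size_sort -cardE. Qed.

Lemma set_of_choice p (J : p.+1.-tuple 'I_k.+1) (c : p.+1.-tuple box) :
  is_rows J -> is_choice J c ->
  [/\ is_route [set x in c], chain [set x in c] = c &
      cJ K J = (route_weight [set x in c])^-1].
Proof.
move=> /andP[sJ /eqP lJ] /eqP cJE.
have sc : sorted ltn (map (@box_rank N w h) c).
  by rewrite [map _ c]cJE (path_sorted sJ).
have chainE : chain [set x in c] = c.
  by apply/esym/sorted_chainE => // x; rewrite inE.
have Uc := sorted_uniq ltn_trans ltnn sc.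
have le_k x : x \in c -> (box_rank x <= k)%N.
  move=> /(map_f (@box_rank N w h)); rewrite [map _ c]cJE => /mapP[j _ ->].
  by rewrite -ltnS ltn_ord.
have injR : {in [set x in c] &, injective rowof}.
  move=> x y; rewrite !inE => xc yc xy; apply: (uniq_map_inj_in Uc) => //.
  by rewrite /box_rank xy.
split=> //.
  apply/routeP; split=> // [|x]; last by rewrite inE; exact: le_k.
  have lc : last 0%N (map (@box_rank N w h) c) = k by rewrite [map _ c]cJE.
  have [z zc zk] : exists2 z, z \in (c : seq box) & box_rank z = k.
    case/lastP: (c : seq box) (size_tuple c) lc => // c' z _.
    by rewrite map_rcons last_rcons; exists z; rewrite ?mem_rcons ?mem_head.
  by rewrite -(row_number_inj zk) imset_f // inE.
rewrite /route_weight prodfV invrK big_imset //= /cJ.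
rewrite -(big_map (fun j : 'I_k.+1 => j : nat) (fun i => i < k)%N
  (fun i => (lam N w h i)%:R - (lam N w h k)%:R + k%:R - i%:R)).
rewrite -cJE big_map [RHS](eq_bigl (mem c)) => [|x]; last by rewrite inE.
rewrite -big_uniq /=; last exact: map_uniq Uc.
rewrite big_mkcond; apply: eq_big_seq => x xc.
by rewrite weight_row_number // -row_number_le_r0 le_k.
Qed.

(** A pair (J, c) is the list of boxes of a route sorted from the top, together
    with the list of their row numbers. *)
Lemma olver_sum T : olver K x1 T =
  \sum_(R | is_route R) ((-1) ^+ #|R|.-1 * route_weight R) *: slide x1 K R T.
Proof.
pose pred_card R : 'I_k := insubd (Ordinal (row_number_gt0 r0)) #|R|.-1.
rewrite (partition_big pred_card xpredT) //=; apply: eq_bigr => p _.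
under [LHS]eq_bigr => J _ do rewrite /tau scaler_sumr.
rewrite pair_big_dep /=.
pose D := [set q : p.+1.-tuple 'I_k.+1 * p.+1.-tuple box |
  is_rows q.1 && is_choice q.1 q.2].
pose boxes (q : p.+1.-tuple 'I_k.+1 * p.+1.-tuple box) := [set x in q.2].
have boxesI : {in D &, injective boxes}.
  move=> [J c] [J' c']; rewrite !inE /= => /andP[rJ cJ] /andP[rJ' cJ'] e.
  have [_ ch _] := set_of_choice rJ cJ; have [_ ch' _] := set_of_choice rJ' cJ'.
  have cc : c = c' by apply: val_inj; rewrite /= -ch -ch'; congr chain.
  congr pair => //; apply/val_inj/(inj_map val_inj) => /=.
  by rewrite -(eqP cJ) cc (eqP cJ').
have pred_cardE R : is_route R -> pred_card R = #|R|.-1 :> nat.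
  move=> /card_route/andP[R0 le_k]; rewrite insubdK //.
  by rewrite unfold_in /= prednK.
rewrite [RHS](eq_bigl (mem (boxes @: D))) => [|R]; last first.
  apply/andP/imsetP => [[rR /eqP pR]|[[J c] /[!inE] /andP[rJ cJ] ->]]; last first.
    have [rR ch _] := set_of_choice rJ cJ; split=> //; apply/eqP/val_inj.
    by rewrite /= pred_cardE // -size_chain ch size_tuple.
  have sz : size (chain R) == p.+1.
    have /andP[R0 _] := card_route rR.
    by rewrite size_chain -(prednK R0) -pred_cardE // pR.
  have szJ : size (map (fun x => inord (box_rank x) : 'I_k.+1) (chain R)) == p.+1.
    by rewrite size_map.
  have [injR _ le_k] := routeP _ rR.
  have JE : map (@nat_of_ord _) (Tuple szJ) = map (@box_rank N w h) (Tuple sz).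
    rewrite /= -map_comp; apply/eq_in_map => x; rewrite mem_chain => /le_k xk /=.
    by rewrite inordK.
  exists (Tuple szJ, Tuple sz); last by apply/setP => x; rewrite inE mem_chain.
  rewrite inE /is_rows /is_choice /= JE eqxx andbT chain_last // eqxx andbT.
  rewrite path_min_sorted ?chain_sorted //.
  by apply/allP => _ /mapP[x _ ->]; exact: row_number_gt0.
rewrite big_imset; last exact: boxesI.
apply: eq_big => [q|q /andP[rJ cJ]]; first by rewrite inE.
have [rR ch ->] := set_of_choice rJ cJ.
have [injR _ _] := routeP _ rR.
rewrite invrK tens_shift_filling; first by rewrite -size_chain ch size_tuple.
- by rewrite -ch chain_sorted.
- by rewrite -ch chain_last.
Qed.

End Olver.

(** * 1-paths and routes *)

Section Paths.
Variables (N : nat) (w h : nat -> nat) (x1 : box N w h).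
Local Notation brow := (brow N h).
Local Notation box := (box N w h).
Local Notation rowof := (@box_row N w h).
Local Notation r0 := (box_row x1).
Local Notation k := (row_number r0).
Hypothesis x1_low : tagged r0 = 0%N :> nat.
Implicit Types (r s : brow) (x y : box) (R : {set box}) (u v : option box).
Local Notation cyc := (cyc x1).

Definition route_path R : {ffun option box -> option box} :=
  [ffun u => if u is None then None else prev (cyc R) u].

Definition length_above R := size (chain (R :\ x1)).

Lemma size_cyc R : size (cyc R) = (length_above R).+2.
Proof. by rewrite /= size_rcons size_map. Qed.

Lemma nth_cyc_bottom R : nth None (cyc R) (length_above R).+1 = Some x1.
Proof. by rewrite /= nth_rcons size_map /length_above ltnn eqxx. Qed.

Lemma prev_cyc_None R : prev (cyc R) None = Some x1.
Proof.
rewrite prev_nth mem_head /= memNindex.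
  rewrite size_rcons size_map; exact: nth_cyc_bottom.
by have /andP[] := cyc_uniq x1 R.
Qed.

Lemma prev_cyc_nth R i : (i <= length_above R)%N ->
  prev (cyc R) (nth None (cyc R) i.+1) = nth None (cyc R) i.
Proof.
move=> i_d; rewrite prev_nth mem_nth ?size_cyc //=.
rewrite index_uniq // ?size_rcons ?size_map //.
by have /andP[] := cyc_uniq x1 R.
Qed.

Lemma in_cyc_nth R u : u \in cyc R -> u != None ->
  exists2 i, (i <= length_above R)%N & u = nth None (cyc R) i.+1.
Proof.
move=> uC u0; have := uC; rewrite -index_mem size_cyc.
case: (index u _) (nth_index None uC) => [/esym/eqP|i e lt]; last by exists i.
by rewrite (negPf u0).
Qed.

Lemma route_path_nth R i : (i <= length_above R)%N ->
  route_path R (nth None (cyc R) i.+1) = nth None (cyc R) i.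
Proof.
move=> le_i; rewrite ffunE; case e: (nth _ _ i.+1) => [x|].
  by rewrite -e prev_cyc_nth.
have : nth None (cyc R) i.+1 == nth None (cyc R) 0 by rewrite e.
by rewrite nth_uniq ?size_cyc ?cyc_uniq // ltnS.
Qed.

Lemma route_path_cyc R : {in cyc R, forall u, route_path R u \in cyc R}.
Proof.
by move=> [x|] uC; rewrite ffunE // mem_prev.
Qed.

Section Route.
Variable R : {set box}.
Hypothesis routeR : is_route x1 R.

(** The last entry x_1 of [cyc] is left out (j <= length_above R): it may lie in
    the row of the entry before it. *)
Lemma rank_cyc_nth i j : (i < j)%N -> (j <= length_above R)%N ->
  (rank (nth None (cyc R) i) < rank (nth None (cyc R) j))%N.
Proof.
have [injR _ _] := routeP x1_low _ routeR => lt_ij le_j.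
have injR1 : {in R :\ x1 &, injective rowof}.
  by move=> x y /setD1P[_ xR] /setD1P[_ yR]; exact: injR.
have srt : sorted ltn (map (@rank N w h) (None :: map Some (chain (R :\ x1)))).
  rewrite /= -map_comp path_min_sorted ?chain_sorted //.
  by apply/allP => _ /mapP[x _ ->]; exact: row_number_gt0.
have E a : (a <= length_above R)%N -> rank (nth None (cyc R) a) =
    nth 0%N (map (@rank N w h) (None :: map Some (chain (R :\ x1)))) a.
  move=> le_a; rewrite (nth_map None) /= ?size_map ?ltnS //.
  rewrite -[cyc R]/(rcons (None :: map Some (chain (R :\ x1))) (Some x1)).
  by rewrite nth_rcons /= size_map ltnS le_a.
rewrite !E ?(leq_trans (ltnW lt_ij)) //.
apply: (sorted_ltn_nth ltn_trans); rewrite // inE size_map /= size_map ltnS //.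
by rewrite (leq_trans (ltnW lt_ij)).
Qed.

Lemma rank_cyc_le u : u \in cyc R -> (rank u <= k)%N.
Proof.
have [_ _ le_k] := routeP x1_low _ routeR.
rewrite mem_cyc !inE -orbA => /or3P[/imsetP[x xR ->]|/eqP->|/eqP->] //.
exact: le_k.
Qed.

Lemma rank_cyc_lt u : x1 \in R -> u \in cyc R -> u != Some x1 -> (rank u < k)%N.
Proof.
have [injR _ _] := routeP x1_low _ routeR.
move=> x1R uC ux1; rewrite ltn_neqAle rank_cyc_le // andbT.
move: uC ux1; rewrite mem_cyc !inE -orbA.
case/or3P=> [/imsetP[x xR ->]|/eqP->|/eqP->]; rewrite ?eqxx //= => xx1.
  by apply: contra xx1 => /eqP/row_number_inj/injR->.
by rewrite eq_sym -lt0n row_number_gt0.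
Qed.

Lemma route_path_le u : (rank (route_path R u) <= rank u)%N.
Proof.
have [uC|uC] := boolP (u \in cyc R); last first.
  by case: u uC => [x|] uC; rewrite ffunE // prev_nth (negPf uC).
have [->|u0] := eqVneq u None; first by rewrite ffunE.
have [i le_i e] := in_cyc_nth uC u0.
have -> : route_path R u = nth None (cyc R) i by rewrite e route_path_nth.
move: le_i; rewrite leq_eqVlt => /predU1P[ei|lt_i].
  by rewrite e ei nth_cyc_bottom rank_cyc_le // mem_nth // size_cyc.
by rewrite e ltnW // rank_cyc_nth.
Qed.

Lemma route_path_lt x : x \in R ->
  (rank (route_path R (Some x)) < rank (Some x))%N.
Proof.
move=> xR; rewrite ffunE.
have xC : Some x \in cyc R by rewrite mem_cyc !inE imset_f.
case: (in_cyc_nth xC isT) => i; rewrite leq_eqVlt => /predU1P[->|lt_i] e.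
  have xx1 : x = x1 by move: e; rewrite nth_cyc_bottom => -[].
  rewrite e prev_cyc_nth // nth_cyc_bottom; apply: rank_cyc_lt.
  - by rewrite -xx1.
  - by rewrite mem_nth // size_cyc.
  by rewrite -(nth_cyc_bottom R) nth_uniq ?size_cyc ?cyc_uniq // neq_ltn ltnSn.
by rewrite e prev_cyc_nth ?rank_cyc_nth // ltnW.
Qed.

Lemma route_path_mono x y : x \in R -> y \in R ->
  (rank (Some x) < rank (Some y))%N ->
  (rank (route_path R (Some x)) < rank (route_path R (Some y)))%N.
Proof.
move=> xR yR lt_xy; rewrite !ffunE.
have inC z : z \in R -> Some z \in cyc R by move=> zR; rewrite mem_cyc !inE imset_f.
have [i le_i ei] := in_cyc_nth (inC x xR) isT.
have [j le_j ej] := in_cyc_nth (inC y yR) isT.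
rewrite ei ej !prev_cyc_nth // rank_cyc_nth //.
rewrite ltnNge; apply: contraTN lt_xy; rewrite leq_eqVlt -leqNgt.
case/predU1P => [eij|lt_ji]; first by rewrite ei ej eij.
move: le_i; rewrite leq_eqVlt => /predU1P[eis|lt_i].
  by rewrite [Some x]ei eis nth_cyc_bottom rank_cyc_le ?inC.
by rewrite ei ej ltnW // rank_cyc_nth.
Qed.

(** The j-th iterate from x_1 is the entry of [cyc] at j places from its end. *)
Lemma orbit_route_path u : (u \in orbit (route_path R) (Some x1)) = (u \in cyc R).
Proof.
rewrite -fconnect_orbit; apply/idP/idP => [uO|uC].
  rewrite -(iter_findex uO); elim: (findex _ _ _) => [|m IH] /=.
    by rewrite mem_cyc !inE eqxx orbT.
  exact: route_path_cyc.
have iterE j i : (i + j = (length_above R).+1)%N ->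
    iter j (route_path R) (Some x1) = nth None (cyc R) i.
  elim: j i => [|j IH] i e; first by rewrite -(addn0 i) e nth_cyc_bottom.
  by rewrite iterS (IH i.+1) ?addSnnS // route_path_nth //; lia.
have ui : (index u (cyc R) <= (length_above R).+1)%N by rewrite -ltnS -size_cyc index_mem.
by rewrite -(nth_index None uC) -(iterE _ _ (subnKC ui)) fconnect_iter.
Qed.

Lemma one_path_route : down_closure (rowof @: R) = rowof @: R ->
  one_path x1 (route_path R) R.
Proof.
move=> clR; have [injR r0R le_k] := routeP x1_low _ routeR.
rewrite /one_path; cbv zeta; apply/and5P; split; last (apply/and4P; split).
- apply/and3P; split.
  + have /imsetP[x xR rx] := r0R; apply/exists_inP; exists x => //.
    by rewrite /xlevel -rx x1_low eqxx andbT -[box_block x]/(tag (rowof x)) -rx.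
  + apply/forall_inP => x xR; apply/forall_inP => y yR; apply/implyP => /eqP e.
    exact/eqP/injR.
  + apply/forall_inP => x xR; apply/forallP => r; apply/implyP => /andP[/eqP e lt].
    have : r \in rowof @: R.
      rewrite -clR; apply/down_closureP; exists (rowof x).
      by rewrite imset_f // ltnW // eq_sym e.
    by case/imsetP => y yR ->; apply/exists_inP; exists y.
- by apply/forallP => u; rewrite box_leE route_path_le.
- by apply/forall_inP => _ /imsetP[x xR ->]; rewrite box_ltE route_path_lt.
- by rewrite orbit_route_path mem_head.
- by apply/eqP/setP => u; rewrite [LHS]inE orbit_route_path mem_cyc.
- apply/forall_inP => _ /imsetP[x xR ->]; apply/forall_inP => _ /imsetP[y yR ->].
  apply/implyP => /and4P[/eqP eb lt_xy _ _].
  rewrite box_ltE route_path_mono //= row_number_ltE -val_eqE /=.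
  by apply/orP; right; apply/andP; split; [apply/eqP; exact: eb | exact: lt_xy].
- apply/forallP => u; apply/implyP => uRX.
  case: u uRX => [x|_]; last by rewrite ffunE.
  move=> xRX; rewrite ffunE prev_nth mem_cyc inE (negPf xRX) /= inE /=.
  by rewrite eqxx.
apply/eqP/setP => u; apply/imsetP/idP => [[v vRX ->]|uR].
  have vC : v \in cyc R by rewrite mem_cyc inE vRX.
  have v0 : v != None.
    by apply: contraTneq vRX => ->; rewrite !inE orbF; apply/imsetP => -[].
  have := route_path_cyc vC; rewrite mem_cyc.
  have vx : route_path R v != Some x1.
    rewrite ffunE; case: v v0 {vRX vC} => // x _.
    by rewrite -(prev_cyc_None R) (inj_eq (can_inj (next_prev (cyc_uniq x1 R)))).
  by rewrite !inE (negPf vx) /= orbF.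
have uC : u \in cyc R.
  by move: uR; rewrite mem_cyc !inE => /orP[/andP[_ ->]|->]; rewrite ?orbT.
have ux1 : u != Some x1.
  by move: uR; rewrite !inE => /orP[/andP[]|/eqP->].
have n0 : next (cyc R) u != None.
  apply: contra_neq ux1 => e.
  by rewrite -(prev_next (cyc_uniq x1 R) u) e prev_cyc_None.
exists (next (cyc R) u); last first.
  rewrite ffunE; case e: (next _ _) n0 => [x|] // _.
  by rewrite -e (prev_next (cyc_uniq x1 R)).
have := mem_next (cyc R) u; rewrite uC mem_cyc inE => /orP[//|].
by rewrite inE (negPf n0).
Qed.

End Route.
End Paths.

Section PathSum.
Variables (N : nat) (w h : nat -> nat) (x1 : box N w h).
Local Notation brow := (brow N h).
Local Notation box := (box N w h).
Local Notation rowof := (@box_row N w h).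
Local Notation r0 := (box_row x1).
Hypothesis x1_low : tagged r0 = 0%N :> nat.
Implicit Types (r s : brow) (x y : box) (R : {set box}) (u v : option box).
Local Notation cyc := (cyc x1).
Local Notation path_fun := {ffun option box -> option box}.
Implicit Types P : path_fun.

(** The boxes of R are in the orbit of x_1, along which the rank decreases, so
    none of them is below the row of x_1; the last clause of an evacuation route
    is the closure of its rows. *)
Lemma one_path_is_route P R : one_path x1 P R ->
  is_route x1 R /\ down_closure (rowof @: R) = rowof @: R.
Proof.
rewrite /one_path; cbv zeta.
case/and5P => /and3P[/exists_inP[x0 x0R /andP[bx0 lx0]] injR clR] leP ltP _.
case/and4P => /eqP orbE _ _ _; split.
  apply/(routeP x1_low); split.
  - move=> x y xR yR e; move/forall_inP/(_ x xR)/forall_inP/(_ y yR): injR.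
    by rewrite e eqxx => /eqP.
  - apply/imsetP; exists x0 => //; apply/esym/eqP/brow_eqP; split.
      exact/eqP.
    by rewrite x1_low; apply/eqP.
  move=> x xR; have : Some x \in orbit P (Some x1).
    by move/setP/(_ (Some x)): orbE; rewrite inE => ->; rewrite !inE imset_f.
  rewrite -fconnect_orbit => xO; rewrite -[box_rank x]/(rank (Some x)).
  rewrite -(iter_findex xO); elim: (findex _ _ _) => //= m; apply: leq_trans.
  by have := forallP leP (iter m P (Some x1)); rewrite box_leE.
apply/eqP; rewrite eqEsubset sub_down_closure andbT.
apply/subsetP => r /down_closureP[_ [/imsetP[x xR ->] e le]].
have [/eqP->|rx] := boolP (r == rowof x); first exact: imset_f.
have lt : (tagged r < tagged (rowof x))%N.
  rewrite ltn_neqAle le andbT; apply: contra rx => /eqP el.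
  by apply/brow_eqP; split=> //; apply/esym/eqP.
move/forall_inP/(_ x xR)/forallP/(_ r)/implyP: clR.
rewrite eq_sym in e; case/(_ _)/exists_inP => [|y yR /eqP<-]; last exact: imset_f.
by apply/andP; split.
Qed.

(** P maps R + x_1 onto (R - x_1) + y_1 and moves boxes of R strictly upwards.
    Going up along R from x_1, each box u of the target is hit by some u'; boxes
    below the one just under u already have other images, and boxes above it
    cannot come down to u. *)
Lemma one_path_eq P R : one_path x1 P R -> P = route_path x1 R.
Proof.
move=> PR; have [routeR clR] := one_path_is_route PR.
move: PR; rewrite /one_path; cbv zeta.
case/and5P => _ leP ltP _ /and4P[_ _ /forallP idP /eqP imP].
have PN : P None = None.
  have := forallP leP None; rewrite box_leE; case: (P None) => [x|//].
  by rewrite leqNgt rank_Some_gt0.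
have Pnth i : (i <= length_above x1 R)%N ->
    P (nth None (cyc R) i.+1) = nth None (cyc R) i.
  move=> le_i; move: {2}(_ - i)%N (erefl (length_above x1 R - i)%N) => j.
  (* Induction on the distance j to the bottom of [cyc]. *)
  elim/ltn_ind: j i le_i => j IH i le_i ej.
  have vC : nth None (cyc R) i \in cyc R by rewrite mem_nth // size_cyc ltnS ltnW.
  have vx1 : nth None (cyc R) i != Some x1.
    rewrite -(nth_cyc_bottom x1 R) nth_uniq ?size_cyc ?cyc_uniq //.
      by rewrite neq_ltn ltnS le_i.
    by rewrite ltnS ltnW.
  have : nth None (cyc R) i \in P @: ([set Some x | x in R] :|: [set Some x1]).
    rewrite imP; move: vC; rewrite mem_cyc !inE (negPf vx1) orbF => /orP[->|->] //.
    by rewrite orbT.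
  case/imsetP => u uRX vE.
  have uC : u \in cyc R by rewrite mem_cyc inE uRX.
  have u0 : u != None.
    by apply: contraTneq uRX => ->; rewrite !inE orbF; apply/imsetP => -[].
  have [i' le_i' uE] := in_cyc_nth uC u0.
  have [lt_ii'|lt_i'i|ii'] := ltngtP i i'; last by rewrite {1}ii' -uE -vE.
    have lt_j : (length_above x1 R - i' < j)%N by lia.
    have := IH _ lt_j i' le_i' erefl; rewrite -uE -vE => /eqP.
    rewrite nth_uniq ?size_cyc ?cyc_uniq ?ltnS ?(leqW le_i') ?(leqW le_i) //.
    by rewrite (ltn_eqF lt_ii').
  have uR : u \in [set Some x | x in R].
    move: uRX; rewrite inE => /orP[//|]; rewrite inE uE -(nth_cyc_bottom x1 R).
    rewrite nth_uniq ?size_cyc ?cyc_uniq ?ltnS ?(leqW le_i') //; lia.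
  have := forall_inP ltP _ uR; rewrite box_ltE -vE.
  have -> // : (rank (nth None (cyc R) i) < rank u)%N = false.
  apply/negbTE; rewrite -leqNgt uE.
  have [->//|lt] := eqVneq i'.+1 i.
  by rewrite ltnW // rank_cyc_nth // ltn_neqAle lt.
apply/ffunP => u; have [->|u0] := eqVneq u None; first by rewrite PN ffunE.
have [uC|uC] := boolP (u \in cyc R).
  have [i le_i ->] := in_cyc_nth uC u0.
  by rewrite Pnth // route_path_nth.
rewrite ffunE; case: u u0 uC => // x _ uC.
rewrite prev_nth (negPf uC); apply/eqP/(implyP (idP _)).
by move: uC; rewrite mem_cyc inE => /norP[].
Qed.

Lemma source_route_path R u : u != Some x1 ->
  source x1 (route_path x1 R) u = odflt x1 (next (cyc R) u).
Proof.
move=> ux1; rewrite /source; case: pickP => [x /eqP|no].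
  by rewrite ffunE => <-; rewrite (next_prev (cyc_uniq x1 R)).
case e: (next _ _) => [x|] //; have := no x; rewrite ffunE -e.
by rewrite (prev_next (cyc_uniq x1 R)) eqxx.
Qed.

Variables (K : numFieldType) (n : nat).
Implicit Types T : filling n box.

Lemma path_act_route R T : path_act K x1 (route_path x1 R) T = slide x1 K R T.
Proof.
rewrite /path_act source_route_path //.
congr (tens _ (cls _ _ _)); apply/ffunP => y; rewrite !ffunE source_route_path //.
exact: (valP y).
Qed.

Lemma Phi1_sum T : Phi1 K x1 T =
  \sum_(R | is_route x1 R && (down_closure (rowof @: R) == rowof @: R))
    ((-1) ^+ #|R| / Hpath K x1 R) *: slide x1 K R T.
Proof.
pose D := [set PR : path_fun * {set box} | one_path x1 PR.1 PR.2].
have sndI : {in D &, injective snd}.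
  move=> [P R] [P' R']; rewrite !inE /= => PR PR' e.
  by rewrite (one_path_eq PR) (one_path_eq PR') e.
rewrite [RHS](eq_bigl (mem (snd @: D))) => [|R]; last first.
  apply/andP/imsetP => [[routeR /eqP clR]|[[P R'] /[!inE] /= PR ->]].
    by exists (route_path x1 R, R); rewrite ?inE //; exact: one_path_route.
  by have [routeR clR] := one_path_is_route PR; rewrite clR.
rewrite big_imset; last exact: sndI.
apply: eq_big => [PR|[P R] /= PR]; first by rewrite inE.
have [/(routeP x1_low)[/imset_injP injR _ _] _] := one_path_is_route PR.
by rewrite (one_path_eq PR) path_act_route /height (eqP injR).
Qed.

End PathSum.

(** * Comparison of the two maps *)

Section Comparison.
Variables (N : nat) (w h : nat -> nat) (x1 : box N w h).
Hypothesis hblocks : block_form N w h.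
Local Notation brow := (brow N h).
Local Notation box := (box N w h).
Local Notation rowof := (@box_row N w h).
Local Notation r0 := (box_row x1).
Hypothesis x1_low : tagged r0 = 0%N :> nat.
Variables (K : numFieldType) (n : nat).
Implicit Types (r : brow) (R : {set box}) (S D : {set brow}).

Lemma sum_routes_by_rows (M : lmodType K) (Q : pred {set brow})
    (c : {set brow} -> K) (F : {set box} -> M) :
  \sum_(R | is_route x1 R && Q (rowof @: R)) c (rowof @: R) *: F R =
  \sum_(S | admissible x1 S && Q S) c S *: \sum_(R | selects S R) F R.
Proof.
rewrite (partition_big (fun R => rowof @: R)
  (fun S => admissible x1 S && Q S)) => [|R /andP[/andP[_ ->] ->]] //.
apply: eq_bigr => S /andP[admS QS]; rewrite scaler_sumr.
apply: eq_big => [R|R /andP[_ /eqP-> //]].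
rewrite /is_route /selects; have [->|_] := eqVneq (rowof @: R) S; last by rewrite andbF.
by rewrite admS QS !andbT eq_sym.
Qed.

Lemma admissible_down_closure S D : admissible x1 D ->
  admissible x1 S && (down_closure S == D) = (r0 \in S) && (down_closure S == D).
Proof.
case/andP => _ /forall_inP leD; rewrite /admissible -andbA.
congr (_ && _); case: eqP => [clS|_]; last by rewrite andbF.
rewrite andbT; apply/forall_inP => r rS; apply: leD.
by rewrite -clS; apply: subsetP rS; exact: sub_down_closure.
Qed.

Lemma down_closure_admissible S : admissible x1 S -> admissible x1 (down_closure S).
Proof.
case/andP => r0S /forall_inP leS; apply/andP; split.
  by apply: subsetP r0S; exact: sub_down_closure.
apply/forall_inP => r /down_closureP[s [/leS le_s /eqP e _]].
by rewrite -e.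
Qed.

(** All S with closure D contribute the same vector up to sign, so that only their
    coefficients have to be added, by [sum_weights]. *)
Lemma sum_by_down_closure (M : lmodType K) (F : {set brow} -> M) :
  (forall S, r0 \in S -> (-1) ^+ #|down_closure S| *: F (down_closure S) =
     (-1) ^+ #|S| *: F S) ->
  \sum_(S | admissible x1 S)
    ((-1) ^+ #|S| * \prod_(r in S) (weight x1 K (tag r) (tagged r))^-1) *: F S =
  \sum_(D | admissible x1 D && (down_closure D == D))
    ((-1) ^+ #|D| / \prod_(b < N | (box_block x1 < b)%N &&
       [exists r in D, tag r == b]) Hblock K x1 b) *: F D.
Proof.
move=> F_cl.
rewrite (partition_big (@down_closure N h)
  (fun D => admissible x1 D && (down_closure D == D))) => [|S admS]; last first.
  by rewrite down_closure_admissible // down_closureK eqxx.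
apply: eq_bigr => D /andP[admD /eqP clD].
have /andP[r0D /forall_inP leD] := admD.
rewrite (eq_bigl _ _ (fun S => admissible_down_closure S admD)).
rewrite -(sum_weights hblocks x1_low K clD r0D leD) mulr_sumr scaler_suml.
apply: eq_bigr => S /andP[r0S /eqP clS].
by rewrite ![_ * \prod_(r in S) _]mulrC -!scalerA -clS F_cl.
Qed.

Lemma Phi1_olver (T : filling n box) : Phi1 K x1 T = - olver K x1 T.
Proof.
rewrite (olver_sum hblocks x1_low) (Phi1_sum x1_low).
pose Q S := down_closure S == S.
transitivity (\sum_(D | admissible x1 D && Q D) ((-1) ^+ #|D| /
    \prod_(b < N | (box_block x1 < b)%N && [exists r in D, tag r == b])
       Hblock K x1 b) *: slide_rows x1 K T D).
  rewrite -sum_routes_by_rows; apply: eq_bigr => R /andP[/and3P[/eqP cR _ _] _].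
  rewrite cR /Hpath; congr ((_ / _) *: _); apply: eq_bigl => b; congr (_ && _).
  apply/exists_inP/exists_inP => -[z zR zb].
    by exists (rowof z); rewrite ?imset_f.
  by case/imsetP: zR => y yR zy; exists y; rewrite // /box_block -[tag y]/(rowof y) -zy.
rewrite -(@sum_by_down_closure _ (slide_rows x1 K T)); last first.
  move=> S; apply: alternating_down_closure => {}S r s r0S sS rS rs lt_sr.
  exact: (@slide_rows_insert N w h x1 K n T x1_low S r s).
transitivity (\sum_(R | is_route x1 R && xpredT (rowof @: R))
    ((-1) ^+ #|rowof @: R| * route_weight x1 K R) *: slide x1 K R T).
  rewrite (sum_routes_by_rows xpredT (fun S => (-1) ^+ #|S| *
    \prod_(r in S) (weight x1 K (tag r) (tagged r))^-1)).
  by apply: eq_bigl => S; rewrite andbT.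
rewrite -sumrN; apply: eq_big => [R|R /andP[routeR _]]; first by rewrite andbT.
have /andP[R0 _] := card_route x1_low routeR; have /andP[/eqP-> _] := routeR.
by rewrite -scaleNr -mulNr -[in LHS](prednK R0) exprS mulN1r.
Qed.

End Comparison.

Lemma linear_cls_oppr (K : fieldType) (n : nat) (rT B : finType) (row : B -> rT)
    (M : lmodType K) (f g : {linear schur K n row -> M}) :
  (forall T, f (cls K row T) = - g (cls K row T)) -> forall q, f q = - g q.
Proof.
move=> fg q; rewrite -(vproj_repr q); move: (repr q) => x.
have -> : x = \sum_(T : filling n B) x T *: fbasis K T.
  apply/ffunP => T; rewrite sum_ffunE (bigD1 T) //= !ffunE eqxx big1 ?addr0.
    by rewrite [_ *: _]mulr1.
  by move=> T' /negPf TT'; rewrite !ffunE eq_sym TT' scaler0.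
rewrite linear_sum !linear_sum; apply: eq_bigr => T _.
by rewrite !linearZ /= -/(cls K row T) fg scalerN.
Qed.

Theorem theorem8p1 (R : realType) (n N : nat) (w h : nat -> nat)
    (hblocks : block_form N w h) (hn : (size (parts N w h) <= n)%N)
    (b1 : 'I_N) (x1 : box N w h) (hx1 : is_corner b1 x1) :
  (forall T : filling n (box N w h), Phi1 R[i] x1 T = - olver R[i] x1 T) /\
  (forall Phi Phit :
      {linear Slam N w h R[i] n -> tensV n (Smu R[i] n x1)},
    induced_by (@Phi1 N w h R[i] n x1) Phi ->
    induced_by (@olver N w h R[i] n x1) Phit ->
    forall v, Phi v = - Phit v).
Proof.
case: hx1 => _ x1_low _.
have PhiE T := @Phi1_olver N w h x1 hblocks x1_low R[i] n T.
split=> // Phi Phit PhiP PhitP v.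
apply: linear_cls_oppr => T; rewrite PhiP PhitP; exact: PhiE.
Qed.
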